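(* Let $P_n$ be embedded into $IA_n\subseteq\mathrm{Aut}(F_n)$ via the Artin action. Then for every $j\ge1$, \[\Gamma_j(P_n)=\Gamma_j(IA_n)\cap P_n=\mathcal A_j\cap P_n.\]
   Context: $F_n$ is free on $(x_1,\dots,x_n)$, $\Gamma_*$ is the lower central series, $IA_n$ is the group of automorphisms of $F_n$ acting trivially on $F_n^{ab}$, and $\mathcal A_j$ is the subgroup of automorphisms $\sigma$ of $F_n$ with $\sigma(x)x^{-1}\in\Gamma_{j+1}(F_n)$ for all $x\in F_n$. The braid group $B_n$ (generators $\sigma_1,\dots,\sigma_{n-1}$) acts faithfully on $F_n$ by the Artin action: $\sigma_i(x_i)=x_ix_{i+1}x_i^{-1}$, $\sigma_i(x_{i+1})=x_i$, $\sigma_i(x_t)=x_t$ for $t\ne i,i+1$ (this is conjugation action of $B_n\subseteq B_{n+1}$ on $x_i=A_{i,n+1}$). The pure braid group $P_n$ (kernel of $B_n\to S_n$) maps into $IA_n$ and $B_n\cap IA_n=P_n$. *)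

(* Defs.v *)
From mathcomp Require Import all_boot.
Set Implicit Arguments. Unset Strict Implicit. Unset Printing Implicit Defensive.

(* A letter (i, b) stands for x_i if b = false and x_i^{-1} if b = true.
   Elements of F_n are words all of whose letters have index < n,
   considered up to free reduction. *)
Definition letter := (nat * bool)%type.
Definition word := seq letter.

Definition word_in (n : nat) (w : word) : bool := all (fun l => l.1 < n) w.

Definition inv_letter (l : letter) : letter := (l.1, ~~ l.2).
Definition inv_word (w : word) : word := rev (map inv_letter w).

Definition push (l : letter) (w : word) : word :=
  match w with
  | l' :: w' => if l' == inv_letter l then w' else l :: w
  | [::] => [:: l]
  end.
Definition red (w : word) : word := foldr push [::] w.

Definition weq (u v : word) : Prop := red u = red v.

Definition commW (u v : word) : word := inv_word u ++ inv_word v ++ u ++ v.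

Inductive genW (n : nat) (S : word -> Prop) : word -> Prop :=
| genW_base w : word_in n w -> S w -> genW n S w
| genW_nil : genW n S [::]
| genW_cat u v : genW n S u -> genW n S v -> genW n S (u ++ v)
| genW_inv u : genW n S u -> genW n S (inv_word u)
| genW_eq u v : genW n S u -> word_in n v -> weq u v -> genW n S v.

(* lower central series of F_n: Gamma_1 = F_n, Gamma_{k+1} = [Gamma_k, F_n]
   (Gamma_0 is also set to F_n; it is never used) *)
Fixpoint lcsF (n k : nat) : word -> Prop :=
  match k with
  | 0 => fun w => word_in n w
  | k'.+1 =>
    match k' with
    | 0 => fun w => word_in n w
    | _ => genW n (fun w => exists u v, lcsF n k' u /\ word_in n v /\ w = commW u v)
    end
  end.

(* an endomorphism is given by the images f i of the generators x_i, i < n *)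
Definition End := nat -> word.

Definition is_end (n : nat) (f : End) : Prop := forall i, i < n -> word_in n (f i).

Definition subst (f : End) (w : word) : word :=
  flatten (map (fun l => if l.2 then inv_word (f l.1) else f l.1) w).

Definition comp (f g : End) : End := fun i => subst f (g i).

Definition idE : End := fun i => [:: (i, false)].

Definition eeq (n : nat) (f g : End) : Prop := forall i, i < n -> weq (f i) (g i).

Definition inverse (n : nat) (f g : End) : Prop :=
  is_end n g /\ eeq n (comp f g) idE /\ eeq n (comp g f) idE.

Definition is_aut (n : nat) (f : End) : Prop := is_end n f /\ exists g, inverse n f g.

Inductive genA (n : nat) (S : End -> Prop) : End -> Prop :=
| genA_base f : is_aut n f -> S f -> genA n S f
| genA_id : genA n S idE
| genA_mul f g : genA n S f -> genA n S g -> genA n S (comp f g)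
| genA_inv f g : genA n S f -> inverse n f g -> genA n S g
| genA_eq f g : genA n S f -> is_end n g -> eeq n f g -> genA n S g.

Fixpoint lcsA (n : nat) (H : End -> Prop) (k : nat) : End -> Prop :=
  match k with
  | 0 => H
  | k'.+1 =>
    match k' with
    | 0 => H
    | _ => genA n (fun c => exists a b a' b',
               lcsA n H k' a /\ H b /\ inverse n a a' /\ inverse n b b' /\
               c = comp a' (comp b' (comp a b)))
    end
  end.

(* IA_n: automorphisms acting trivially on F_n^ab (exponent sums of f(x_i)) *)
Definition IA (n : nat) (f : End) : Prop :=
  is_aut n f /\
  forall i j, i < n -> j < n ->
    count (pred1 (j, false)) (f i) = count (pred1 (j, true)) (f i) + (i == j).

Definition Andr (n j : nat) (f : End) : Prop :=
  is_aut n f /\ forall x, word_in n x -> lcsF n j.+1 (subst f x ++ inv_word x).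

Definition sigmaA (i : nat) : End := fun t =>
  if t == i then [:: (i, false); (i.+1, false); (i, true)]
  else if t == i.+1 then [:: (i, false)]
  else [:: (t, false)].
Definition sigmaAinv (i : nat) : End := fun t =>
  if t == i then [:: (i.+1, false)]
  else if t == i.+1 then [:: (i.+1, true); (i, false); (i.+1, false)]
  else [:: (t, false)].

(* a braid word: a sequence of sigma_i^{+-1} (b = true means inverse), i+1 < n *)
Definition bword := seq (nat * bool).
Definition bword_in (n : nat) (w : bword) : bool := all (fun s => s.1.+1 < n) w.

Definition artin (w : bword) : End :=
  foldr (fun s f => comp (if s.2 then sigmaAinv s.1 else sigmaA s.1) f) idE w.

Definition transp (i t : nat) : nat :=
  if t == i then i.+1 else if t == i.+1 then i else t.
Definition bperm (w : bword) : nat -> nat :=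
  foldr (fun s p => fun t => transp s.1 (p t)) id w.

Definition Pn (n : nat) (f : End) : Prop :=
  exists w : bword, bword_in n w /\ (forall t, bperm w t = t) /\ eeq n (artin w) f
                    /\ is_end n f.

(* Main.v *)
(** The proof is by induction on the number of strands, through the splitting
    P_(n+1) = N ⋊ P_n with N generated by the loops of the last strand around the others
    (obtained by combing).  Killing the last letter x_n sends an element b = a p of
    P_(n+1) ∩ A_j to p, which therefore lies in P_n ∩ A_j and, by induction, in Γ_j(P_n).
    There remains a in N ∩ A_j.  It maps x_n to x_n^w, where w modulo x_n is the word
    expressing a in the generators of N, so it suffices to show that [w, x_n] ∈ Γ_(j+1)
    forces w, modulo x_n, into Γ_j.

    This last fact (usually read off from the Magnus embedding and the
    Magnus-Witt theorem) is obtained for weighted free groups by Lazard elimination: a letter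
    x of minimal weight is traded for the letters [y, x, ..., x], that is, one passes
    from the free group to the kernel of its projection onto <x>, realised inside the
    holomorph of another free group.  Weights increase, and once they all reach j
    there is nothing left to prove. *)
Require Import Defs.
From HB Require Import structures.
From mathcomp Require Import all_boot all_algebra.
From mathcomp.classical Require Import boolp.
From mathcomp Require Import zify ring.
Set Implicit Arguments. Unset Strict Implicit. Unset Printing Implicit Defensive.
Local Open Scope group_scope.

(** * The free group as the group of reduced words *)

(** The inclusions of Γ_j(P_n) in Γ_j(IA_n) and of Γ_j(IA_n) in A_j are formal; the second holds
    because the automorphisms moving an N-series by k steps form an N-series themselves. The
    difficulty is the way back from A_j to Γ_j(P_n): there [w, x_n] determines w only up to powers
    of x_n, whence a conclusion modulo x_n. No filtration of a weighted free group is computed. To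
    have weight k means to land in step k of every N-series, in every group, that gives the letters
    their weights; such a hypothesis can be tested in any convenient group. The Heisenberg group
    shows that the exponent sum of the letter x to be eliminated is zero, so that the word lies in
    the kernel of the projection onto <x>; the holomorph rewrites it in the new letters. That kernel
    needs infinitely many generators, but commutators with k or more entries x have weight at least
    k and are dropped, so the list of weighted letters stays finite. One free group [FG] on
    countably many letters serves all n: P_n then sits inside P_(n+1), and all automorphisms live in
    the single group [bij FG]. *)

Lemma inv_letterK : involutive inv_letter.
Proof. by case=> i b; rewrite /inv_letter /= negbK. Qed.

Definition reduced (w : word) : bool := sorted (fun l l' => l' != inv_letter l) w.

Lemma reduced_push l w : reduced w -> reduced (push l w).
Proof.
case: w => [|l' w] //=; case: ifP => [_|/negbT ll'] /=; last by rewrite ll'.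
exact: path_sorted.
Qed.

Lemma reduced_red w : reduced (red w).
Proof. by elim: w => //= l w IH; apply: reduced_push. Qed.

Lemma reduced_id w : reduced w -> red w = w.
Proof.
elim: w => //= l w IH rw; rewrite IH; last exact: path_sorted rw.
by case: w rw {IH} => //= l' w /andP[/negbTE ->].
Qed.

Lemma pushK l w : reduced w -> push (inv_letter l) (push l w) = w.
Proof.
case: w => [|l' w] /=; first by rewrite inv_letterK eqxx.
case: ifP => [/eqP -> {l'}|_ _] /=; last by rewrite inv_letterK eqxx.
by case: w => //= l' w /andP[]; rewrite inv_letterK => /negbTE ->.
Qed.

(** Van der Waerden's argument: by [pushK] a letter and its inverse act on reduced words as inverse
    operations, so a cancelling pair has no effect. *)
Lemma foldr_push_red u w : reduced w -> foldr push w (red u) = foldr push w u.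
Proof.
move=> rw; elim: u => //= l u <-.
case: (red u) (reduced_red u) => //= l' z rz; case: ifP => // /eqP ->.
rewrite -[X in push X (push _ _)]inv_letterK pushK //.
by elim: (z) => //= l1 z1; apply: reduced_push.
Qed.

Lemma red_cat u v : red (u ++ v) = foldr push (red v) u.
Proof. by rewrite /red foldr_cat. Qed.

Lemma red_catl u v : red (red u ++ v) = red (u ++ v).
Proof. by rewrite !red_cat foldr_push_red // reduced_red. Qed.

Lemma red_catr u v : red (u ++ red v) = red (u ++ v).
Proof. by rewrite !red_cat [red (red v)]reduced_id // reduced_red. Qed.

Lemma red_invl w : red (inv_word w ++ w) = [::].
Proof.
elim: w => //= l w IH; rewrite /inv_word /= rev_cons cat_rcons red_cat /=.
by rewrite pushK; [rewrite -red_cat | apply: reduced_red].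
Qed.

Record FG := MkFG { fgw :> seq letter; fgwP : reduced fgw }.
HB.instance Definition _ := [isSub for fgw].
HB.instance Definition _ := [Choice of FG by <:].

Definition fgpi (w : word) : FG := MkFG (reduced_red w).

Lemma fgpi_val (g : FG) : fgpi g = g.
Proof. by apply: val_inj; rewrite /= reduced_id // fgwP. Qed.

Lemma weqP u v : weq u v <-> fgpi u = fgpi v.
Proof. by split=> [e|[]//]; apply: val_inj. Qed.

Definition fg_mul (g h : FG) := fgpi (g ++ h).
Definition fg_inv (g : FG) := fgpi (inv_word g).

Fact fg_mulA : associative fg_mul.
Proof. by move=> g h k; apply: val_inj; rewrite /= red_catl red_catr catA. Qed.
Fact fg_mul1 : left_id (fgpi [::]) fg_mul.
Proof. by move=> g; rewrite /fg_mul /= fgpi_val. Qed.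
Fact fg_mulr1 : right_id (fgpi [::]) fg_mul.
Proof. by move=> g; rewrite /fg_mul /= cats0 fgpi_val. Qed.
Fact fg_mulV : left_inverse (fgpi [::]) fg_inv fg_mul.
Proof. by move=> g; apply: val_inj; rewrite /= red_catl red_invl. Qed.
Fact fg_mulVr : right_inverse (fgpi [::]) fg_inv fg_mul.
Proof.
move=> g; rewrite -[LHS]fg_mul1 -{1}(fg_mulV (fg_inv g)) -fg_mulA.
by rewrite (fg_mulA (fg_inv g)) fg_mulV fg_mul1 fg_mulV.
Qed.

HB.instance Definition _ :=
  isGroup.Build FG fg_mulA fg_mul1 fg_mulr1 fg_mulV fg_mulVr.

Definition X (i : nat) : FG := fgpi [:: (i, false)].

Lemma fgpi_nil : fgpi [::] = 1. Proof. by []. Qed.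

Lemma fgpi_cat u v : fgpi (u ++ v) = fgpi u * fgpi v.
Proof. by apply: val_inj; rewrite /= red_catl red_catr. Qed.

Lemma fgpi_inv w : fgpi (inv_word w) = (fgpi w)^-1.
Proof.
apply/eqP; rewrite -mulg_eq1 -fgpi_cat; apply/eqP/val_inj => /=.
exact: red_invl.
Qed.

Lemma fgpi_comm u v : fgpi (commW u v) = [~ fgpi u, fgpi v].
Proof. by rewrite /commW !fgpi_cat !fgpi_inv. Qed.

Lemma fgpi_letter l : fgpi [:: l] = if l.2 then (X l.1)^-1 else X l.1.
Proof. by case: l => i [] //=; rewrite -fgpi_inv. Qed.

Lemma fgpi_cons l w : fgpi (l :: w) = fgpi [:: l] * fgpi w.
Proof. by rewrite -fgpi_cat. Qed.

Lemma fg_ind (P : FG -> Prop) :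
  P 1 -> (forall i, P (X i)) -> (forall g, P g -> P g^-1) ->
  (forall g h, P g -> P h -> P (g * h)) -> forall g, P g.
Proof.
move=> P1 PX PV PM g; rewrite -(fgpi_val g); elim: (fgw g) => [|l w IH] //.
rewrite fgpi_cons; apply: PM => //; rewrite fgpi_letter.
by case: ifP => _ //; apply: PV.
Qed.

(** * Homomorphisms and the universal property of the free group *)

Definition ishom (G H : groupType) (f : G -> H) := {morph f : g h / g * h}.

Section HomTheory.
Variables (G H K : groupType).

Lemma hom1 (f : G -> H) : ishom f -> f 1 = 1.
Proof. by move=> hf; apply: (@mulgI _ (f 1)); rewrite -hf !mulg1. Qed.

Lemma homV (f : G -> H) : ishom f -> {morph f : g / g^-1}.
Proof.
by move=> hf g; apply: (@mulgI _ (f g)); rewrite -hf !mulgV hom1.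
Qed.

Lemma homR (f : G -> H) : ishom f -> {morph f : g h / [~ g, h]}.
Proof. by move=> hf g h; rewrite !commgEl !conjgE !hf !homV. Qed.

Lemma hom_comp (f : H -> K) (f' : G -> H) : ishom f -> ishom f' -> ishom (fun g => f (f' g)).
Proof. by move=> hf hf' g h; rewrite hf' hf. Qed.

End HomTheory.

Lemma hom_ext (G : groupType) (f f' : FG -> G) :
  ishom f -> ishom f' -> (forall i, f (X i) = f' (X i)) -> f =1 f'.
Proof.
move=> hf hf' e; elim/fg_ind => [|//|g IH|g h IHg IHh].
- by rewrite !hom1.
- by rewrite !homV // IH.
- by rewrite hf hf' IHg IHh.
Qed.

Section Eval.
Variables (G : groupType) (r : nat -> G).

Definition evl (l : letter) : G := if l.2 then (r l.1)^-1 else r l.1.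
Definition ev (w : word) : G := foldr (fun l g => evl l * g) 1 w.

Lemma evl_inv l : evl (inv_letter l) = (evl l)^-1.
Proof. by case: l => i [] //=; rewrite /evl /= invgK. Qed.

Lemma ev_cat u v : ev (u ++ v) = ev u * ev v.
Proof. by elim: u => /= [|l u ->]; rewrite ?mul1g ?mulgA. Qed.

Lemma ev_push l w : ev (push l w) = evl l * ev w.
Proof.
by case: w => //= l' w; case: ifP => //= /eqP ->; rewrite evl_inv mulVKg.
Qed.

Lemma ev_red w : ev (red w) = ev w.
Proof. by elim: w => //= l w IH; rewrite ev_push IH. Qed.

Definition fev (g : FG) : G := ev g.

Lemma fev_pi w : fev (fgpi w) = ev w. Proof. exact: ev_red. Qed.

Lemma fev_hom : ishom fev.
Proof. by move=> g h; rewrite {1}/fev ev_red ev_cat. Qed.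

Lemma fevX i : fev (X i) = r i.
Proof. by rewrite fev_pi /= mulg1. Qed.

End Eval.

Lemma fevX_id : fev X =1 id.
Proof. by apply: hom_ext => [|//|i]; rewrite ?fevX //; exact: fev_hom. Qed.

(** * The group of bijections of a type *)

Record bij (T : Type) := MkBij {
  bfwd :> T -> T; bbwd : T -> T; bfwdK : cancel bfwd bbwd; bbwdK : cancel bbwd bfwd }.

HB.instance Definition _ T := gen_eqMixin (bij T).
HB.instance Definition _ T := gen_choiceMixin (bij T).

Lemma bij_ext T (b c : bij T) : b =1 c -> b = c.
Proof.
case: b c => f g fK gK [f' g' fK' gK'] /= /funext e; case: _ / e in fK' gK' *.
have e : g = g' by apply/funext => x; rewrite -{1}[x]gK' fK.
by case: _ / e in fK' gK' *; congr MkBij; apply: Prop_irrelevance.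
Qed.

Section BijGroup.
Variable T : Type.
Implicit Types b c d : bij T.

Definition bij_mul b c : bij T :=
  MkBij (can_comp (bfwdK b) (bfwdK c)) (can_comp (bbwdK c) (bbwdK b)).
Definition bij_one : bij T := @MkBij T id id (fun=> erefl) (fun=> erefl).
Definition bij_inv b : bij T := MkBij (bbwdK b) (bfwdK b).

Fact bij_mulA : associative bij_mul. Proof. by move=> b c d; apply: bij_ext. Qed.
Fact bij_mul1 : left_id bij_one bij_mul. Proof. by move=> b; apply: bij_ext. Qed.
Fact bij_mulr1 : right_id bij_one bij_mul. Proof. by move=> b; apply: bij_ext. Qed.
Fact bij_mulV : left_inverse bij_one bij_inv bij_mul.
Proof. by move=> b; apply: bij_ext => x; exact: bfwdK. Qed.
Fact bij_mulVr : right_inverse bij_one bij_inv bij_mul.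
Proof. by move=> b; apply: bij_ext => x; exact: bbwdK. Qed.

HB.instance Definition _ :=
  isGroup.Build (bij T) bij_mulA bij_mul1 bij_mulr1 bij_mulV bij_mulVr.

Lemma bijM b c x : (b * c) x = b (c x). Proof. by []. Qed.
Lemma bij1 x : (1 : bij T) x = x. Proof. by []. Qed.
Lemma bijK b x : b^-1 (b x) = x. Proof. exact: bfwdK. Qed.
Lemma bijVK b x : b (b^-1 x) = x. Proof. exact: bbwdK. Qed.

End BijGroup.

Section BijAut.
Variable F : groupType.
Implicit Types b c : bij F.

Lemma hom_bij1 : ishom (1 : bij F). Proof. by []. Qed.
Lemma hom_bijM b c : ishom b -> ishom c -> ishom (b * c).
Proof. exact: hom_comp. Qed.
Lemma hom_bijV b : ishom b -> ishom b^-1.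
Proof. by move=> hb g h; rewrite -{1}(bijVK b g) -{1}(bijVK b h) -hb bijK. Qed.

Definition transl (g : F) : bij F := MkBij (mulKg g) (mulVKg g).

Lemma translE g h : transl g h = g * h. Proof. by []. Qed.
Lemma transl_hom : ishom transl.
Proof. by move=> g h; apply: bij_ext => x; rewrite bijM !translE mulgA. Qed.

(** The semidirect product rule: inside [bij F] an automorphism acts on F, seen as its left
    translations, by evaluation. *)
Lemma transl_conj b g : ishom b -> b * transl g * b^-1 = transl (b g).
Proof. by move=> hb; apply: bij_ext => x; rewrite !bijM !translE hb bijVK. Qed.

End BijAut.

Lemma bij_hom_ext (b c : bij FG) :
  ishom b -> ishom c -> (forall i, b (X i) = c (X i)) -> b = c.
Proof. by move=> hb hc e; apply: bij_ext; apply: hom_ext. Qed.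

(** * N-series and the lower central series *)

(** For identities valid in every group: commutators are expanded, products associated to the left
    and cancelled, after which both sides should agree. *)
Ltac gnorm := rewrite /commg /conjg ?(invgM, invgK);
  rewrite ?(mulgA, mulgK, mulgVK, mulVg, mulgV, mulg1, mul1g, invgK, invg1).

Section CommutatorIdentities.
Variable G : groupType.
Implicit Types x y z : G.

Lemma comm_mull x y z : [~ x * y, z] = [~ x, z] ^ y * [~ y, z].
Proof. by gnorm. Qed.

Lemma comm_mulr x y z : [~ x, y * z] = [~ x, z] * [~ x, y] ^ z.
Proof. by gnorm. Qed.

Lemma comm_invr x y : [~ x, y^-1] = ([~ x, y] ^ y^-1)^-1.
Proof. by gnorm. Qed.

Lemma conjg_comm x y : x ^ y = x * [~ x, y].
Proof. by gnorm. Qed.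

Lemma hall_witt x y z :
  [~ x, y^-1, z] ^ y * [~ y, z^-1, x] ^ z * [~ z, x^-1, y] ^ x = 1.
Proof. by gnorm. Qed.

(** The three subgroups lemma for single elements, from [hall_witt]. Stability of N is asked only
    under the conjugations that occur, because the levels it is applied to need not be normal in all
    of G. *)
Lemma three_commutators (N : G -> Prop) x y z :
  (forall g h, N g -> N h -> N (g * h)) -> (forall g, N g -> N g^-1) ->
  (forall g, N g -> N (g ^ y^-1)) -> (forall g, N g -> N (g ^ z)) ->
  (forall g, N g -> N (g ^ x)) ->
  N [~ y, z^-1, x] -> N [~ z, x^-1, y] -> N [~ x, y^-1, z].
Proof.
move=> NM NV Jy Jz Jx Nyz Nzx.
rewrite -[[~ x, y^-1, z]](conjgK y); apply: (Jy).
have := hall_witt x y z; rewrite -mulgA => /eqP; rewrite mulg_eq1 => /eqP ->.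
by apply: NV; apply: NM; [apply: Jz | apply: Jx].
Qed.

End CommutatorIdentities.

(** Indices start at 0 so that normality is a case of [nsR]: every level is normalised by level 0,
    which may be smaller than G. *)
Record nseries (G : groupType) (S : nat -> G -> Prop) : Prop := NSeries {
  ns1 : forall k, S k 1;
  nsM : forall k g h, S k g -> S k h -> S k (g * h);
  nsV : forall k g, S k g -> S k g^-1;
  nsS : forall k g, S k.+1 g -> S k g;
  nsR : forall k l g h, S k g -> S l h -> S (k + l)%N [~ g, h] }.

Section NSeriesTheory.
Variables (G : groupType) (S : nat -> G -> Prop).
Hypothesis nS : nseries S.

Lemma ns_leq k l g : (k <= l)%N -> S l g -> S k g.
Proof.
move=> /subnK <-; elim: (_ - _)%N => // d IH; rewrite addSn => /(nsS nS); exact: IH.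
Qed.

Lemma nsJ k g h : S k g -> S 0%N h -> S k (g ^ h).
Proof.
by move=> Sg Sh; rewrite conjg_comm; apply: nsM => //; have := nsR nS Sg Sh; rewrite addn0.
Qed.

Lemma nsJV k g h : S k g -> S 0%N h -> S k (h * g * h^-1).
Proof. by move=> Sg Sh; have := nsJ Sg (nsV nS Sh); rewrite /conjg invgK mulgA. Qed.

Lemma ns_pullback (F : groupType) (f : F -> G) :
  ishom f -> nseries (fun k g => S k (f g)).
Proof.
move=> hf; split=> *; rewrite ?hf ?(homV hf) ?(homR hf) ?(hom1 hf).
- exact: ns1.
- exact: nsM.
- exact: nsV.
- exact: nsS.
- exact: nsR.
Qed.

(* Hence, when S is minimal, whether f moves S down by m steps can be tested on generators. *)
Lemma ns_shift (f : G -> G) m : ishom f ->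
  nseries (fun k g => S k g /\ S (k + m)%N (f g * g^-1)).
Proof.
move=> hf; have S0 k g : S k g -> S 0%N g by exact: ns_leq.
split=> [k|k g h [Sg Fg] [Sh Fh]|k g [Sg Fg]|k g [Sg Fg]|k l g h [Sg Fg] [Sh Fh]].
- by rewrite hom1 // mulgV; split; apply: ns1.
- split; first exact: nsM.
  have -> : f (g * h) * (g * h)^-1 = (f g * g^-1) * (g * (f h * h^-1) * g^-1).
    by rewrite hf invgM !mulgA mulgVK.
  by apply: nsM => //; apply: nsJV => //; apply: S0 Sg.
- split; first exact: nsV.
  have -> : f g^-1 * g^-1^-1 = ((f g * g^-1) ^ g)^-1.
    by rewrite (homV hf) /conjg mulgVK invgM !invgK.
  by apply: nsV => //; apply: nsJ => //; apply: S0 Sg.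
- by split; [apply: nsS Sg | apply: nsS Fg].
split; first exact: nsR.
move: (f g * g^-1) (f h * h^-1) Fg Fh (mulgVK g (f g)) (mulgVK h (f h)) => a b Sa Sb eg eh.
have Hg : S 0%N g by apply: S0 Sg.
have Hh : S 0%N h by apply: S0 Sh.
have Hb : S l b by apply: ns_leq Sb; rewrite leq_addr.
(* With f g = a g and f h = b h, the displacement of [g, h] splits into a commutator with entry a
   and one with entry b; each gains m. *)
have -> : f [~ g, h] * [~ g, h]^-1 =
    [~ a, b * h] ^ g * ([~ g, h] * [~ g, b] ^ h * [~ g, h]^-1).
  by rewrite (homR hf) -eg -eh comm_mull (comm_mulr g) -[LHS]mulgA.
apply: nsM => //.
  apply: nsJ => //; rewrite addnAC; apply: nsR => //; apply: nsM => //.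
apply: nsJV => //; last by apply: S0 (nsR nS Sg Sh).
by apply: nsJ => //; rewrite -addnA; apply: nsR.
Qed.

End NSeriesTheory.

(** * Subgroups and their lower central series *)

Inductive gen (G : groupType) (P : G -> Prop) : G -> Prop :=
| gen_base g : P g -> gen P g
| gen_1 : gen P 1
| gen_M g h : gen P g -> gen P h -> gen P (g * h)
| gen_V g : gen P g -> gen P g^-1.

Record subgrp (G : groupType) (H : G -> Prop) : Prop := SubGrp {
  sg1 : H 1; sgM : forall g h, H g -> H h -> H (g * h); sgV : forall g, H g -> H g^-1 }.

Lemma sgR (G : groupType) (H : G -> Prop) g h : subgrp H -> H g -> H h -> H [~ g, h].
Proof.
by move=> sH Hg Hh; do ![apply: (sgM sH) | apply: (sgV sH)].
Qed.

Lemma gen_min (G : groupType) (P H : G -> Prop) :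
  subgrp H -> (forall g, P g -> H g) -> forall g, gen P g -> H g.
Proof.
move=> sH PH g; elim=> [h /PH //||h h' _ Hh _ Hh'|h _ Hh]; first exact: sg1.
- exact: sgM.
- exact: sgV.
Qed.

Lemma gen_subgrp (G : groupType) (P : G -> Prop) : subgrp (gen P).
Proof. by split; [exact: gen_1 | exact: gen_M | exact: gen_V]. Qed.

Fixpoint lcs (G : groupType) (H : G -> Prop) (k : nat) : G -> Prop :=
  match k with
  | 0 => H
  | k'.+1 =>
    match k' with
    | 0 => H
    | _ => gen (fun c => exists a b, [/\ lcs H k' a, H b & c = [~ a, b]])
    end
  end.

Lemma lcsSS (G : groupType) (H : G -> Prop) k :
  lcs H k.+2 = gen (fun c => exists a b, [/\ lcs H k.+1 a, H b & c = [~ a, b]]).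
Proof. by []. Qed.

Section LCS.
Variables (G : groupType) (H : G -> Prop).
Hypothesis sH : subgrp H.

Lemma lcs_subgrp k : subgrp (lcs H k).
Proof. by case: k => [|[|k]] //; apply: gen_subgrp. Qed.

Lemma lcs_sub k g : lcs H k g -> H g.
Proof.
elim: k g => [|[|k] IH] // g; rewrite lcsSS; apply: gen_min => // _ [a [b [/IH Ha Hb ->]]].
exact: sgR.
Qed.

Lemma lcsJ k g h : lcs H k g -> H h -> lcs H k (g ^ h).
Proof.
elim: k g h => [|[|k] IH] g h; try by move=> *; do ![apply: (sgM sH) | apply: (sgV sH)].
move=> Lg Hh; elim: Lg => [_ [a [b [La Hb ->]]]||g1 g2 _ L1 _ L2|g1 _ L1].
- rewrite conjRg; apply: gen_base; exists (a ^ h), (b ^ h); split=> //; first exact: IH.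
  by do ![apply: (sgM sH) | apply: (sgV sH)].
- by rewrite conj1g; apply: gen_1.
- by rewrite conjMg; apply: gen_M.
- by rewrite conjVg; apply: gen_V.
Qed.

Lemma lcsS k g : lcs H k.+1 g -> lcs H k g.
Proof.
case: k => [|k] //; rewrite lcsSS; apply: gen_min; first exact: lcs_subgrp.
move=> _ [a [b [La Hb ->]]]; have sL := lcs_subgrp k.+1.
by rewrite commgEl; apply: (sgM sL); [apply: (sgV sL) | apply: lcsJ].
Qed.

Lemma lcsR1 k g h : lcs H k g -> H h -> lcs H k.+1 [~ g, h].
Proof.
by case: k => [|k] Lg Hh; [apply: sgR | apply: gen_base; exists g, h].
Qed.

(** The commutator rule is an induction on l: for a generator [a, b] of level l, [three_commutators]
    trades [a, b, g] for commutators in which a meets g or [b, g], up to inverses, and a lies one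
    level lower. *)
Lemma lcs_nseries : nseries (lcs H).
Proof.
split=> [k|k g h|k g|k g|k l].
- exact: sg1 (lcs_subgrp k).
- exact: (sgM (lcs_subgrp k)).
- exact: (sgV (lcs_subgrp k)).
- exact: lcsS.
elim: l k => [|[|l] IH] k g h Lg Lh.
- by rewrite addn0; apply: lcsS; apply: lcsR1.
- by rewrite addn1; apply: lcsR1.
have Hg := lcs_sub Lg; have sL := lcs_subgrp (k + l.+2); rewrite lcsSS in Lh.
suff [] : H h /\ lcs H (k + l.+2) [~ g, h] by [].
elim: Lh => [_ [a [b [La Hb ->]]]||h1 h2 _ [H1 L1] _ [H2 L2]|h1 _ [H1 L1]].
- have Ha := lcs_sub La; split; first exact: sgR.
  rewrite -invgR; apply: (sgV sL); rewrite -[b]invgK.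
  apply: three_commutators; rewrite ?invgK; try by move=> *; apply: lcsJ.
  + exact: (sgM sL).
  + exact: (sgV sL).
  + rewrite -(addSnnS k l.+1); apply: IH => //; rewrite -invgR.
    apply: (sgV (lcs_subgrp _)); apply: lcsR1; last exact: (sgV sH).
    exact: (sgV (lcs_subgrp _)).
  + rewrite addnS; apply: lcsR1; last exact: (sgV sH).
    by apply: IH => //; apply: (sgV (lcs_subgrp _)).
- by rewrite commg1; split; [exact: sg1 | exact: sg1].
- rewrite comm_mulr; split; first exact: (sgM sH).
  by apply: (sgM sL) => //; apply: lcsJ.
rewrite comm_invr; split; first exact: (sgV sH).
by apply: (sgV sL); apply: lcsJ => //; apply: (sgV sH).
Qed.

Lemma lcs_hom (G' : groupType) (H' : G' -> Prop) (f : G -> G') k g :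
  ishom f -> (forall h, H h -> H' (f h)) -> lcs H k g -> lcs H' k (f g).
Proof.
move=> hf HH'; elim: k g => [|[|k] IH] g; try exact: HH'.
elim=> [_ [a [b [La Hb ->]]]||g1 g2 _ L1 _ L2|g1 _ L1].
- rewrite (homR hf); apply: gen_base; exists (f a), (f b); split=> //; first exact: IH.
  exact: HH'.
- by rewrite (hom1 hf); apply: gen_1.
- by rewrite hf; apply: gen_M.
- by rewrite (homV hf); apply: gen_V.
Qed.

Lemma lcs_min (G' : groupType) (S : nat -> G' -> Prop) (f : G -> G') k g :
  nseries S -> ishom f -> (forall h, H h -> S 1%N (f h)) -> lcs H k.+1 g -> S k.+1 (f g).
Proof.
move=> nS hf HS; elim: k g => [|k IH] g; first exact: HS.
elim=> [_ [a [b [La Hb ->]]]||g1 g2 _ L1 _ L2|g1 _ L1].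
- by rewrite (homR hf) -addn1; apply: nsR; [exact: nS | exact: IH | exact: HS].
- by rewrite (hom1 hf); apply: ns1.
- by rewrite hf; apply: nsM.
- by rewrite (homV hf); apply: nsV.
Qed.

End LCS.

Lemma lcs_mono (G : groupType) (H H' : G -> Prop) k g :
  (forall h, H h -> H' h) -> lcs H k g -> lcs H' k g.
Proof. exact: (@lcs_hom _ _ _ _ id). Qed.

Lemma subgrpT (G : groupType) : subgrp (fun _ : G => True). Proof. by []. Qed.

(** * Elements that move an N-series by k steps *)

Section Action.
Variables (G : groupType) (S : nat -> G -> Prop).
Hypothesis nS : nseries S.

(** The inverse of f is tested too, since S is not assumed stable under conjugation by f; this makes
    [actsJ] available for both. *)
Definition acts (k : nat) (f : G) : Prop :=
  forall p g, S p g -> S (p + k)%N [~ f, g] /\ S (p + k)%N [~ f^-1, g].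

Lemma actsJ k f p g : acts k f -> S p g -> S p (g ^ f).
Proof.
move=> Af Sg; rewrite conjg_comm -invgR; apply: nsM => //; apply: nsV => //.
by apply: ns_leq (Af _ _ Sg).1 => //; rewrite leq_addr.
Qed.

Lemma actsV k f : acts k f -> acts k f^-1.
Proof. by move=> Af p g /Af[]; rewrite invgK. Qed.

Lemma actsR k f p g : acts k f -> S p g -> S (p + k)%N [~ g, f].
Proof. by move=> Af /Af[Sfg _]; rewrite -invgR; apply: nsV. Qed.

Let acts_mul k f h p g : acts k f -> acts k h -> S p g -> S (p + k)%N [~ f * h, g].
Proof.
move=> Af Ah Sg; rewrite comm_mull; apply: nsM => //; last by case: (Ah _ _ Sg).
by apply: actsJ Ah _; case: (Af _ _ Sg).
Qed.

Let acts_comm k l f h p g :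
  acts k f -> acts l h -> S p g -> S (p + (k + l))%N [~ f, h, g].
Proof.
move=> Af Ah Sg; rewrite -[h]invgK; have S0 := ns_leq nS (leq0n p) Sg.
apply: three_commutators; rewrite ?invgK.
- exact: nsM.
- exact: nsV.
- by move=> *; apply: actsJ Ah _.
- by move=> *; apply: nsJ.
- by move=> *; apply: actsJ Af _.
- rewrite (addnC k) addnA; apply: actsR => //.
  by case: (Ah p g^-1) => //; apply: nsV.
- rewrite addnA; apply: actsR => //; last by apply: actsR => //; apply: actsV.
  exact: actsV.
Qed.

(* Kaloujnine: by the three subgroups lemma, the elements moving S by k steps form an N-series. *)
Lemma acts_nseries : nseries acts.
Proof.
split=> [k p g Sg|k f h Af Ah p g Sg|k f|k f Af p g /Af|k l f h Af Ah p g Sg].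
- by rewrite invg1 comm1g; split; apply: ns1.
- split; first exact: acts_mul.
  by rewrite invgM; apply: acts_mul => //; apply: actsV.
- exact: actsV.
- by rewrite addnS => -[Sf SfV]; split; apply: nsS.
split; first exact: acts_comm.
by rewrite invgR addnC (addnC k) addnC; apply: acts_comm.
Qed.

(** A semidirect product of N-series: mixed commutators of T k with S l fall into S (k + l) because
    T k moves S by k steps. *)
Lemma acts_prod_nseries (T : nat -> G -> Prop) :
  nseries T -> (forall k f, T k f -> acts k f) ->
  nseries (fun k c => exists f g, [/\ T k f, S k g & c = f * g]).
Proof.
move=> nT TA; split.
- by move=> k; exists 1, 1; split; [exact: ns1 | exact: ns1 | rewrite mulg1].
- move=> k _ _ [f [g [Tf Sg ->]]] [f' [g' [Tf' Sg' ->]]].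
  exists (f * f'), (g ^ f' * g'); split; first exact: nsM.
    by apply: nsM => //; apply: actsJ (TA _ _ Tf') _.
  by gnorm.
- move=> k _ [f [g [Tf Sg ->]]]; exists f^-1, (g^-1 ^ f^-1); split; first exact: nsV.
    by apply: actsJ (TA _ _ (nsV nT Tf)) _; apply: nsV.
  by gnorm.
- by move=> k _ [f [g [Tf Sg ->]]]; exists f, g; split=> //; apply: nsS.
move=> k l _ _ [f [g [Tf Sg ->]]] [f' [g' [Tf' Sg' ->]]].
have Tc := nsR nT Tf Tf'; set c := [~ f, f'] in Tc.
(* The expansion of [f g, f' g'] with its T-part c = [f, f'] collected on the left. *)
exists c, ([~ c, g] * ([~ f, g'] ^ c * [~ c, g']) ^ g * [~ g, f' * g']); split=> //; last first.
  by rewrite /c; gnorm.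
have g0 := ns_leq nS (leq0n _) Sg; have g0' := ns_leq nS (leq0n _) Sg'.
apply: nsM => //.
  apply: nsM => //.
    by apply: ns_leq (TA _ _ Tc _ _ Sg).1 => //; rewrite leq_addl.
  apply: nsJ => //; apply: nsM => //.
    by apply: actsJ (TA _ _ Tc) _; rewrite addnC; case: (TA _ _ Tf _ _ Sg').
  by apply: ns_leq (TA _ _ Tc _ _ Sg').1 => //; rewrite leq_addl.
rewrite comm_mulr; apply: nsM => //; first exact: nsR.
by apply: nsJ => //; apply: actsR => //; apply: TA.
Qed.

End Action.

(** * The holomorph of a group with an N-series, inside its bijections *)

Section Holomorph.
Variables (F : groupType) (S : nat -> F -> Prop).
Hypothesis nS : nseries S.

Definition translS k (c : bij F) := exists2 g, S k g & c = transl g.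

Lemma transl_inj : injective (@transl F).
Proof. by move=> g h /(congr1 (fun b : bij F => b 1)); rewrite !translE !mulg1. Qed.

Lemma translS_nseries : nseries translS.
Proof.
have th := @transl_hom F; split.
- by move=> k; exists 1; [exact: ns1 | rewrite hom1].
- by move=> k _ _ [g Sg ->] [h Sh ->]; exists (g * h); [exact: nsM | rewrite th].
- by move=> k _ [g Sg ->]; exists g^-1; [exact: nsV | rewrite homV].
- by move=> k _ [g Sg ->]; exists g => //; apply: nsS.
- by move=> k l _ _ [g Sg ->] [h Sh ->]; exists [~ g, h]; [exact: nsR | rewrite homR].
Qed.

Definition autS k (b : bij F) := ishom b /\ acts translS k b.

Lemma autS_nseries : nseries autS.
Proof.
have nA := acts_nseries translS_nseries; split.
- by move=> k; split; [exact: hom_bij1 | exact: (ns1 nA)].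
- by move=> k b c [hb Ab] [hc Ac]; split; [exact: hom_bijM | exact: (nsM nA)].
- by move=> k b [hb Ab]; split; [exact: hom_bijV | exact: (nsV nA)].
- by move=> k b [hb Ab]; split => //; apply: (nsS nA).
move=> k l b c [hb Ab] [hc Ac]; split; last exact: (nsR nA).
by do ![apply: hom_bijM | apply: hom_bijV].
Qed.

Let comm_transl (b : bij F) g : ishom b -> [~ b, transl g] = transl (b^-1 g^-1 * g).
Proof.
move=> hb; rewrite commgEl conjgE mulgA mulgA -(homV (@transl_hom F)).
rewrite -{2}[b]invgK transl_conj ?transl_hom //; exact: hom_bijV.
Qed.

(** By [comm_transl], the commutator of b with the translation by g^-1 is the translation by the
    displacement of g under b^-1; exchanging b and b^-1 gives the other half. *)
Lemma autSP k (b : bij F) : autS k b <->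
  ishom b /\ (forall p g, S p g -> S (p + k)%N (b g * g^-1) /\ S (p + k)%N (b^-1 g * g^-1)).
Proof.
split=> -[hb Ab]; split=> // p.
  move=> g Sg; have Tg : translS p (transl g^-1) by exists g^-1 => //; apply: nsV.
  have [] := Ab _ _ Tg; rewrite !comm_transl ?invgK //; last exact: hom_bijV.
  by move=> [h Sh /transl_inj ->] [h' Sh' /transl_inj ->].
move=> _ [g Sg ->]; have [|Sb Sb'] := Ab p g^-1; first exact: nsV.
rewrite !comm_transl ?invgK //; last exact: hom_bijV.
by rewrite invgK in Sb Sb'; split; eexists; try reflexivity.
Qed.

Definition holS k (c : bij F) :=
  exists b t, [/\ autS k b, translS k t & c = b * t].

Lemma holS_nseries : nseries holS.
Proof.
by apply: acts_prod_nseries; [exact: translS_nseries | exact: autS_nseries | by move=> k b []].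
Qed.

Lemma holS_aut k b : autS k b -> holS k b.
Proof.
by move=> Ab; exists b, 1; rewrite mulg1; split=> //; apply: ns1; apply: translS_nseries.
Qed.

Lemma holS_transl k g : S k g -> holS k (transl g).
Proof.
move=> Sg; exists 1, (transl g); rewrite mul1g; split=> //; last by exists g.
exact: ns1 autS_nseries k.
Qed.

Lemma transl_holS k g : holS k (transl g) -> S k g.
Proof.
move=> [b [_ [[hb _] [h Sh ->]] e]].
(* Evaluation at h^-1 separates the factors: the translation by h sends it to 1, which the
   automorphism b fixes. *)
have /(congr1 (fun b : bij F => b h^-1)) := e.
rewrite bijM !translE mulgV (hom1 hb) => /eqP; rewrite -eqg_inv.
by rewrite invgF invg1 => /eqP/divg1_eq <-.
Qed.

End Holomorph.

(** * Exponent sums *)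

Section ExponentSums.
Import GRing.Theory.
Local Open Scope ring_scope.

Definition epsw (i : nat) (w : word) : int :=
  (count (pred1 (i, false)) w)%:Z - (count (pred1 (i, true)) w)%:Z.

Lemma epsw_cat i u v : epsw i (u ++ v) = epsw i u + epsw i v.
Proof. by rewrite /epsw !count_cat; lia. Qed.

Lemma epsw_inv i w : epsw i (inv_word w) = - epsw i w.
Proof.
rewrite /epsw /inv_word !count_rev !count_map.
have e b : count (preim inv_letter (pred1 (i, b))) w = count (pred1 (i, ~~ b)) w.
  apply: eq_count => -[l b'] /=; rewrite /inv_letter /= !xpair_eqE /=.
  by case: b; case: b'.
by rewrite !e /=; lia.
Qed.

Lemma epsw_cons i l w : epsw i (l :: w) = epsw i [:: l] + epsw i w.
Proof. by rewrite -epsw_cat. Qed.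

Lemma epsw_red i w : epsw i (red w) = epsw i w.
Proof.
elim: w => //= l w IH; rewrite [in RHS]epsw_cons -IH.
case: (red w) => [|l' z] /=; first by rewrite /epsw /=; lia.
case: ifP => [/eqP ->|_]; last by rewrite epsw_cons.
by rewrite (epsw_cons i (inv_letter l)) -[[:: inv_letter l]]/(inv_word [:: l]) epsw_inv; lia.
Qed.

Definition eps (i : nat) (g : FG) : int := epsw i g.

Lemma eps_pi i w : eps i (fgpi w) = epsw i w. Proof. exact: epsw_red. Qed.

Lemma epsM i g h : eps i (g * h)%g = eps i g + eps i h.
Proof. by rewrite /eps epsw_red epsw_cat. Qed.

Lemma epsV i g : eps i (g^-1)%g = - eps i g.
Proof. by rewrite /eps epsw_red epsw_inv. Qed.

Lemma epsX i j : eps i (X j) = (i == j)%:R.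
Proof. by rewrite eps_pi /epsw /= !xpair_eqE [j == i]eq_sym; case: (i == j). Qed.

Lemma eps_conj i g h : eps i (g ^ h)%g = eps i g.
Proof. by rewrite /conjg !epsM epsV; lia. Qed.

End ExponentSums.

(** The image of v is the power of g given by the exponent sum of x; [H] says so without negative
    exponents. *)
Lemma fev_single (G : groupType) x (g : G) (v : FG) :
  eps x v = 0%R -> fev (fun i => if i == x then g else 1) v = 1.
Proof.
rewrite /eps /epsw => /eqP; rewrite GRing.Theory.subr_eq0 => /eqP[e].
set r := fun i => _.
have H w : ev r w * g ^+ count (pred1 (x, true)) w = g ^+ count (pred1 (x, false)) w.
  elim: w => [|[i b] w IH] /=; first by rewrite mulg1.
  have cg n : commute g (g ^+ n) by apply: commuteX.
  rewrite !xpair_eqE /evl /r /=; case: eqP => _; last first.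
    by rewrite !add0n; case: b; rewrite ?invg1 mul1g.
  case: b => /=; rewrite ?add1n ?add0n ?expgS -mulgA.
    by rewrite cg mulgA mulgA -(mulgA _ (ev r w)) IH -mulgA -cg mulKg.
  by rewrite IH.
by move: (H v); rewrite e => /(canRL (mulgK _)); rewrite mulgV /fev.
Qed.

(** * The Heisenberg group *)

Definition heis := (int * int * int)%type.

Section Heisenberg.
Import GRing.Theory.
Local Open Scope ring_scope.

Definition heis_mul (g h : heis) : heis :=
  (g.1.1 + h.1.1, g.1.2 + h.1.2, g.2 + h.2 + g.1.1 * h.1.2).
Definition heis_inv (g : heis) : heis := (- g.1.1, - g.1.2, - g.2 + g.1.1 * g.1.2).

Fact heis_mulA : associative heis_mul.
Proof. by move=> [[a b] c] [[a' b'] c'] [[p q] r]; rewrite /heis_mul /=; congr (_, _, _); ring. Qed.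
Fact heis_mul1 : left_id (0, 0, 0) heis_mul.
Proof. by move=> [[a b] c]; rewrite /heis_mul /=; congr (_, _, _); ring. Qed.
Fact heis_mulr1 : right_id (0, 0, 0) heis_mul.
Proof. by move=> [[a b] c]; rewrite /heis_mul /=; congr (_, _, _); ring. Qed.
Fact heis_mulV : left_inverse (0, 0, 0) heis_inv heis_mul.
Proof. by move=> [[a b] c]; rewrite /heis_mul /heis_inv /=; congr (_, _, _); ring. Qed.
Fact heis_mulVr : right_inverse (0, 0, 0) heis_inv heis_mul.
Proof. by move=> [[a b] c]; rewrite /heis_mul /heis_inv /=; congr (_, _, _); ring. Qed.

End Heisenberg.

HB.instance Definition _ := Choice.on heis.
HB.instance Definition _ :=
  isGroup.Build heis heis_mulA heis_mul1 heis_mulr1 heis_mulV heis_mulVr.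

Section HeisenbergSeries.
Import GRing.Theory.
Local Open Scope ring_scope.
Variable m : nat.

Lemma heisR (g h : heis) : [~ g, h]%g = (0, 0, g.1.1 * h.1.2 - h.1.1 * g.1.2) :> heis.
Proof.
case: g h => [[a b] c] [[a' b'] c'].
rewrite /commg /conjg -[LHS]/(heis_mul (heis_inv (a, b, c))
  (heis_mul (heis_inv (a', b', c')) (heis_mul (a, b, c) (a', b', c')))).
by rewrite /heis_mul /heis_inv /=; congr (_, _, _); ring.
Qed.

(** The two generators have weights m and 1, and their commutator, the central coordinate, has
    weight m + 1. *)
Definition heisS (l : nat) (h : heis) : Prop :=
  [/\ ((m < l)%N -> h.1.1 = 0), ((1 < l)%N -> h.1.2 = 0) & ((m.+1 < l)%N -> h.2 = 0)].

Lemma heisS_nseries : nseries heisS.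
Proof.
split=> [l|l|l|l|l l'].
- by split.
- move=> [[a b] c] [[a' b'] c'] [/= A B C] [/= A' B' C']; split=> /= hl.
  + by rewrite A // A'.
  + by rewrite B // B'.
  + by rewrite C // C' // A ?mul0r ?addr0 //; exact: ltnW.
- move=> [[a b] c] [/= A B C]; split=> /= hl.
  + by rewrite A // oppr0.
  + by rewrite B // oppr0.
  + by rewrite C // A ?mul0r ?addr0 ?oppr0 //; exact: ltnW.
- move=> [[a b] c] [/= A B C]; split=> /= hl; [apply: A | apply: B | apply: C]; exact: ltnW.
move=> [[a b] c] [[a' b'] c'] [/= A B C] [/= A' B' C']; rewrite heisR; split=> //= hl.
have -> : a * b' = 0.
  have [/A ->|ml] := ltnP m l; first by rewrite mul0r.
  by rewrite B' ?mulr0 //; lia.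
suff -> : a' * b = 0 by rewrite subr0.
have [/A' ->|ml] := ltnP m l'; first by rewrite mul0r.
by rewrite B ?mulr0 //; lia.
Qed.

End HeisenbergSeries.

(** * Elimination *)

(* The letters i < B carry weights om i; all other letters stand for one extra
   generator t of weight 1. *)
Definition comm_deg (B : nat) (om : nat -> nat) (k : nat) (v : FG) : Prop :=
  forall (G : groupType) (S : nat -> G -> Prop) (r : nat -> G) (t : G),
    nseries S -> (forall i, (i < B)%N -> S (om i) (r i)) ->
    (forall i, (B <= i)%N -> r i = t) -> S 1%N t -> S k.+1 [~ fev r v, t].

(** Says that v, with t set to 1, has weight k in the weighted free group; the quantification over
    all N-series replaces a construction of its filtration. *)
Definition kill_deg (B : nat) (om : nat -> nat) (k : nat) (v : FG) : Prop :=
  forall (G : groupType) (S : nat -> G -> Prop) (r : nat -> G),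
    nseries S -> (forall i, (i < B)%N -> S (om i) (r i)) ->
    (forall i, (B <= i)%N -> r i = 1) -> S k (fev r v).

Lemma ns_fev (G : groupType) (S : nat -> G -> Prop) k (r : nat -> G) v :
  nseries S -> (forall i, S k (r i)) -> S k (fev r v).
Proof.
move=> nS Sr; have hr := fev_hom r.
elim/fg_ind: v => [|i|g Sg|g h Sg Sh]; rewrite ?(hom1 hr) ?fevX ?(homV hr) ?hr //.
- exact: ns1.
- exact: nsV.
- exact: nsM.
Qed.

Section Eliminate.
Variables (B : nat) (om : nat -> nat) (k m x : nat).
Hypotheses (m_gt0 : (0 < m)%N) (lt_mk : (m < k)%N) (lt_xB : (x < B)%N) (om_x : om x = m).

Let B' := (B * k)%N.

(* The letter y + B * i (y < B, i < k) stands for the iterated commutator [y, x, ..., x]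
   with i entries x; alp is then conjugation by x, cut off at i = k, where the weight of
   the commutator exceeds k.
   The letter B' stands for t; the letters x + B * i are idle. *)
Let alp (a : nat) : FG := if (a + B < B')%N then X a * X (a + B)%N else X a.

(** Inverse of [alp], from bet a = X a * (bet (a + B))^-1. Each call raises the index by B > 0, so
    B' units of fuel suffice. *)
Fixpoint bet_fuel (d a : nat) : FG :=
  if d is d'.+1 then
    if (a + B < B')%N then X a * (bet_fuel d' (a + B)%N)^-1 else X a
  else X a.

Let bet (a : nat) : FG := bet_fuel B' a.

Let bet_fuelS d a : (B' <= a + d)%N -> bet_fuel d a = bet_fuel d.+1 a.
Proof.
elim: d a => [|d IH] a le_Ba /=; first by case: ifP => //; lia.
by case: ifP => // _; rewrite IH //; lia.
Qed.

Let betE a : bet a = if (a + B < B')%N then X a * (bet (a + B)%N)^-1 else X a.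
Proof. by rewrite {1}/bet bet_fuelS //; lia. Qed.

Let bet_alp : cancel (fev alp) (fev bet).
Proof.
move=> g; apply: (hom_ext (hom_comp (fev_hom bet) (fev_hom alp))) => // i; rewrite fevX /alp.
by rewrite (fun_if (fev bet)) fev_hom !fevX [bet i]betE; case: (_ < B')%N; rewrite ?mulgVK.
Qed.

Let alp_bet : cancel (fev bet) (fev alp).
Proof.
move=> g; apply: (hom_ext (hom_comp (fev_hom alp) (fev_hom bet))) => // i; rewrite fevX.
suff: forall d a, (B' <= a + d)%N -> fev alp (bet a) = X a by apply; apply: leq_addl.
elim=> [|d IH] a le_Ba; rewrite betE.
  by case: ifP => [|e]; [lia | rewrite fevX /alp e].
case: ifP => e; last by rewrite fevX /alp e.
by rewrite fev_hom (homV (fev_hom _)) fevX IH; [rewrite /alp e mulgK | lia].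
Qed.

Let alpB : bij FG := MkBij bet_alp alp_bet.

(** Every entry x adds m. Idle letters get at least k, so that x leaves the letters of weight m. The
    final 1 is the weight of t. *)
Definition elim_om (a : nat) : nat :=
  if (a < B')%N then ((if (a %% B)%N == x then k else om (a %% B)) + m * (a %/ B))%N else 1%N.

Let elim_om_shift a : (a + B < B')%N -> elim_om (a + B) = (elim_om a + m)%N.
Proof.
move=> lt_a; rewrite /elim_om lt_a modnDr (_ : (a < B')%N); last by lia.
by rewrite divnDr ?dvdnn // divnn (_ : (0 < B)%N = true); [lia | lia].
Qed.

(** The smallest N-series giving each letter its weight, as an intersection. Its minimality lets
    [W_shift] test displacements on letters only. *)
Let W l (g : FG) : Prop :=
  forall S, nseries S -> (forall a, S (elim_om a) (X a)) -> S l g.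

Let W_nseries : nseries W.
Proof.
split=> [l S nS SX|l g h Wg Wh S nS SX|l g Wg S nS SX|l g Wg S nS SX|l l' g h Wg Wh S nS SX].
- exact: ns1.
- by apply: nsM => //; [apply: Wg | apply: Wh].
- by apply: nsV => //; apply: Wg.
- by apply: nsS => //; apply: Wg.
- by apply: nsR => //; [apply: Wg | apply: Wh].
Qed.

Let WX a : W (elim_om a) (X a). Proof. by move=> S nS; apply. Qed.

Let W_bet a : W (elim_om a) (bet a).
Proof.
suff: forall d a, (B' <= a + d)%N -> W (elim_om a) (bet a) by apply; apply: leq_addl.
elim=> [|d IH] {}a le_Ba; rewrite betE; case: ifP => e; try by [apply: WX | lia].
apply: (nsM W_nseries) (WX a) _; apply: (nsV W_nseries).
apply: (ns_leq W_nseries) (IH (a + B)%N _); last by lia.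
by rewrite elim_om_shift // leq_addr.
Qed.

Let W_shift (f : FG -> FG) : ishom f ->
  (forall a, W (elim_om a + m)%N (f (X a) * (X a)^-1)) ->
  forall l g, W l g -> W (l + m)%N (f g * g^-1).
Proof.
by move=> hf fX l g Wg; case: (Wg _ (ns_shift W_nseries m hf) (fun a => conj (WX a) (fX a))).
Qed.

Let W0 g : W 0%N g.
Proof.
rewrite -[g]fevX_id; apply: (@ns_fev _ W _ _ _ W_nseries) => i.
exact: (ns_leq W_nseries) (WX i).
Qed.

(** As the image of x in the holomorph, [alpB] has to carry the weight m of x. The cut-off is
    harmless here: it makes [alp] fix the last letters. *)
Let aut_alpB : autS W m alpB.
Proof.
apply/(autSP W_nseries); split; first exact: fev_hom.
move=> l g Wg; split; apply: W_shift Wg; try exact: fev_hom; move=> a /=; rewrite fevX.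
  rewrite /alp; case: ifP => e; last by rewrite mulgV; apply: (ns1 W_nseries).
  by apply: (nsJV W_nseries) => //; rewrite -elim_om_shift.
rewrite betE; case: ifP => e; last by rewrite mulgV; apply: (ns1 W_nseries).
by apply: (nsJV W_nseries) => //; apply: (nsV W_nseries); rewrite -elim_om_shift.
Qed.

(** Lazard elimination: x becomes an automorphism and the other letters become translations. All
    letters from B on stand for t, hence the common image of B'. *)
Let r1 (i : nat) : bij FG := if i == x then alpB else transl (X (if (i < B)%N then i else B')).
Let ra (i : nat) : bij FG := if i == x then alpB else 1.

Let ra_hom v : ishom (fev ra v).
Proof.
have hr := fev_hom ra.
elim/fg_ind: v => [|i|g Hg|g h Hg Hh]; rewrite ?(hom1 hr) ?fevX ?(homV hr) ?hr //.
- by rewrite /ra; case: ifP => _ //; apply: fev_hom.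
- exact: hom_bijV.
- exact: hom_bijM.
Qed.

(** [ra] is [r1] followed by the projection of the holomorph onto its automorphism part, whose
    kernel consists of the translations. *)
Let r1_split v : exists u, fev r1 v = transl u * fev ra v.
Proof.
have hr := fev_hom ra; have hr1 := fev_hom r1; have ht := @transl_hom FG.
elim/fg_ind: v => [|i|g [u Hg]|g h [u Hg] [u' Hh]].
- by exists 1; rewrite (hom1 ht) mulg1 !(hom1 (fev_hom _)).
- rewrite !fevX /r1 /ra; case: eqP => _; last by eexists; rewrite mulg1.
  by exists 1; rewrite (hom1 ht) mul1g.
- exists ((fev ra g)^-1 u^-1); rewrite (homV hr1) (homV hr) Hg invgM -(homV ht).
  by rewrite -transl_conj ?invgK ?mulgK //; apply: hom_bijV.
exists (u * fev ra g u'); rewrite hr1 hr Hg Hh ht -transl_conj //.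
by rewrite !mulgA mulgVK.
Qed.

Let B_gt0 : (0 < B)%N. Proof. exact: leq_ltn_trans lt_xB. Qed.
Let le_BB' : (B <= B')%N. Proof. by rewrite leq_pmulr // (leq_ltn_trans _ lt_mk). Qed.

Let elim_om_small i : (i < B)%N -> i != x -> elim_om i = om i.
Proof.
move=> lt_iB /negbTE ne_ix; rewrite /elim_om modn_small // divn_small // ne_ix muln0 addn0.
by rewrite (leq_trans lt_iB).
Qed.

Lemma elim_om_ge : (forall i, (i < B)%N -> (m <= om i)%N) ->
  forall a, (a < B')%N -> (m <= elim_om a)%N.
Proof.
move=> om_ge a lt_a; rewrite /elim_om lt_a; apply: leq_trans (leq_addr _ _).
by case: ifP => _; [apply: ltnW | apply: om_ge; rewrite ltn_mod].
Qed.

(** Old letters keep their weight, except that x rises to k > m; each new letter has an entry x,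
    hence weight at least 2 m > m. *)
Lemma elim_om_count : (forall i, (i < B)%N -> (m <= om i)%N) ->
  (count (fun a => elim_om a == m) (iota 0 B') < count (fun i => om i == m) (iota 0 B))%N.
Proof.
move=> om_ge; rewrite -(subnKC le_BB') iotaD count_cat add0n.
have -> : count (fun a => elim_om a == m) (iota B (B' - B)) = 0%N.
  apply/eqP; rewrite -leqn0 leqNgt -has_count; apply/hasPn => a.
  rewrite mem_iota (subnKC le_BB') => /andP[le_Ba lt_a]; rewrite /elim_om lt_a.
  have : (0 < a %/ B)%N by rewrite divn_gt0.
  have : (m <= om (a %% B))%N by apply: om_ge; rewrite ltn_mod.
  by case: ifP => _; move: (a %/ B)%N (om _) => q o; nia.
rewrite addn0 -[X in (_ < X)%N]size_filter -(count_predC (pred1 x)) -addn1 addnC leq_add //.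
  rewrite -has_count; apply/hasP; exists x => //=.
  by rewrite mem_filter mem_iota /= add0n lt_xB om_x eqxx.
rewrite count_filter leq_eqVlt; apply/orP; left; apply/eqP/eq_in_count => a.
rewrite mem_iota add0n => lt_aB /=; have [->|ne_ax] := eqVneq a x; last by rewrite elim_om_small.
by rewrite /elim_om modn_small // eqxx (leq_trans lt_xB le_BB') gtn_eqF // ltn_addr.
Qed.

Variable v : FG.
Hypothesis v_comm : comm_deg B om k v.

(** With x and t sent to the generators of the Heisenberg group and the other weighted letters to 1,
    the central coordinate of [v, t] is this exponent sum. It vanishes since its weight m + 1 is
    less than k + 1. *)
Let eps_v : eps x v = 0%R.
Proof.
pose hx : heis := (1%R, 0%R, 0%R); pose ht : heis := (0%R, 1%R, 0%R).
pose r i : heis := if i == x then hx else if (i < B)%N then 1 else ht.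
have hr := fev_hom r.
have e g : (fev r g).1.1 = eps x g.
  elim/fg_ind: g => [|i|g Hg|g h Hg Hh]; rewrite ?(hom1 hr) ?fevX ?(homV hr) ?hr //.
  - by rewrite epsX /r eq_sym; case: eqP => // _; case: ifP.
  - by rewrite epsV -Hg.
  - by rewrite epsM -Hg -Hh.
have [] := v_comm (t := ht) (heisS_nseries m) (r := r).
- move=> i lt_iB; rewrite /r; case: eqP => [->|_]; last first.
    by rewrite lt_iB; apply: ns1 (heisS_nseries m) _.
  by rewrite om_x; split=> //; rewrite ltnn.
- by move=> i le_Bi; rewrite /r; case: eqP => [e1|_]; [lia | rewrite ltnNge le_Bi].
- by split=> //=; rewrite ltnn.
move=> _ _; rewrite heisR /= e GRing.mulr1 GRing.mul0r GRing.subr0; apply.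
by rewrite ltnS.
Qed.

Let v_transl : exists u, fev r1 v = transl u.
Proof. by have [u ->] := r1_split v; exists u; rewrite fev_single // mulg1. Qed.

(** The hypothesis on v is applied in the holomorph, where [v, t] becomes the translation by
    [u, X B']. By minimality of [W] the bound passes to every N-series. *)
Let u_comm u : fev r1 v = transl u -> comm_deg B' elim_om k u.
Proof.
move=> eu G S r t nS Sr rt St.
have : holS W k.+1 [~ fev r1 v, transl (X B')].
  apply: v_comm; first exact: (holS_nseries W_nseries).
  - move=> i lt_iB; rewrite /r1; case: eqP => [->|/eqP ne_ix].
      by rewrite om_x; apply: holS_aut => //; apply: W_nseries.
    by rewrite lt_iB -elim_om_small //; apply: holS_transl => //; apply: W_nseries.
  - move=> i le_Bi; rewrite /r1; case: eqP => [e|_]; first by lia.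
    by rewrite ltnNge le_Bi.
  apply: holS_transl; first exact: W_nseries.
  by have := WX B'; rewrite /elim_om ltnn.
rewrite eu -(homR (@transl_hom FG)) => /transl_holS.
move=> /(_ _ (ns_pullback nS (fev_hom r))); rewrite (homR (fev_hom r)) fevX rt //; apply.
move=> a; rewrite fevX; case: (ltnP a B') => [/Sr //|le_a].
by rewrite /elim_om ltnNge le_a /= rt.
Qed.

Section Back.
Variables (G : groupType) (S : nat -> G -> Prop) (r : nat -> G).
Hypotheses (nS : nseries S) (Sr : forall i, (i < B)%N -> S (om i) (r i)).
Hypothesis r1B : forall i, (B <= i)%N -> r i = 1.

Let rx (i : nat) : G := if i == x then r x else 1.

(** The inverse of x appears because [alpB] models y -> x y x^-1 = y [y, x^-1]. *)
Let r' (a : nat) : G :=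
  if (a < B')%N && (a %% B != x)%N then iter (a %/ B) (fun g => [~ g, (r x)^-1]) (r (a %% B)%N)
  else 1.

Let S0 i : S 0%N (r i).
Proof.
case: (ltnP i B) => [/Sr/(ns_leq nS (leq0n _)) //|/r1B ->]; exact: ns1.
Qed.

Let S0x i : S 0%N (rx i).
Proof. by rewrite /rx; case: ifP => _; [apply: S0 | apply: ns1]. Qed.

Let Sr'k a : (a < B')%N -> S (elim_om a) (r' a).
Proof.
move=> lt_a; rewrite /r' /elim_om lt_a /=; case: eqP => _ /=; first exact: ns1.
elim: (a %/ B)%N => [|d IH] /=; first by rewrite muln0 addn0; apply: Sr; rewrite ltn_mod.
rewrite mulnS addnCA addnC; apply: nsR => //; apply: nsV => //.
by rewrite -om_x; apply: Sr.
Qed.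

Let S0r' a : S 0%N (r' a).
Proof.
case: (ltnP a B') => [/Sr'k/(ns_leq nS (leq0n _)) //|le_a].
by rewrite /r' ltnNge le_a; apply: ns1.
Qed.

(** Congruence modulo S k, a subgroup normalised by S 0; hence the recurring conditions of
    membership in S 0. *)
Let eqm g h := S k (g^-1 * h).

Let eqm_refl g : eqm g g. Proof. by rewrite /eqm mulVg; apply: ns1. Qed.

Let eqm_trans g h l : eqm g h -> eqm h l -> eqm g l.
Proof. by move=> gh hl; have := nsM nS gh hl; rewrite /eqm -mulgA mulVKg. Qed.

Let eqm_sandwich y z p q : S 0%N q -> eqm y z -> eqm (p * y * q^-1) (p * z * q^-1).
Proof.
move=> S0q yz; have := nsJV nS yz S0q.
by rewrite /eqm !invgM invgK !mulgA mulgVK.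
Qed.

Let eqm_hom (f f' : FG -> G) : ishom f -> ishom f' -> (forall g, S 0%N (f g)) ->
  (forall i, eqm (f (X i)) (f' (X i))) -> forall g, eqm (f g) (f' g).
Proof.
move=> hf hf' Sf e; elim/fg_ind => [|//|g Hg|g h Hg Hh].
- by rewrite !hom1.
- rewrite (homV hf) (homV hf') /eqm invgK.
  by have := nsV nS (nsJV nS Hg (Sf g)); rewrite mulVKg invgM invgK.
rewrite hf hf' /eqm.
have -> : (f g * f h)^-1 * (f' g * f' h) = ((f g)^-1 * f' g) ^ f h * ((f h)^-1 * f' h).
  by gnorm.
by apply: nsM => //; apply: nsJ.
Qed.

(** An equality except for the last letters of the chains, where the commutator cut off has k
    entries x and so weight at least k. *)
Let alp_conj a : eqm (fev r' (alp a)) (r x * r' a * (r x)^-1).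
Proof.
have comm_conj y : r x * y * (r x)^-1 = y * [~ y, (r x)^-1] by gnorm.
rewrite /alp; case: ifP => e; rewrite ?fev_hom !fevX.
  have lt_a : (a < B')%N by lia.
  rewrite comm_conj /r' e lt_a modnDr; case: eqP => _ /=; first by rewrite comm1g; apply: eqm_refl.
  by rewrite divnDr ?dvdnn // divnn B_gt0 addn1 /=; apply: eqm_refl.
rewrite comm_conj /eqm mulKg; case: (ltnP a B') => [lt_a|le_a]; last first.
  by rewrite /r' ltnNge le_a /= comm1g; apply: ns1.
have Sx : S m (r x)^-1 by apply: nsV => //; rewrite -om_x; apply: Sr.
apply: ns_leq (nsR nS (Sr'k lt_a) Sx) => //; rewrite /elim_om lt_a.
have : (k.-1 <= a %/ B)%N by rewrite leq_divRL //; move: e; rewrite /B'; nia.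
by move: (a %/ B)%N => q; nia.
Qed.

(* r1 sends words to affine maps of the free group on the new letters; r' intertwines these,
   modulo S k, with the corresponding maps on G. *)
Let transport w g :
  eqm (fev r' (fev r1 w g)) (fev r w * fev r' g * (fev rx w)^-1).
Proof.
have hr := fev_hom r; have hr' := fev_hom r'; have hrx := fev_hom rx; have hr1 := fev_hom r1.
elim/fg_ind: w g => [|i|w IH|w w' IH IH'] g.
- by rewrite (hom1 hr) (hom1 hrx) (hom1 hr1) mul1g invg1 mulg1.
- rewrite !fevX /r1 /rx; case: eqP => [->|/eqP ne_ix] /=.
    apply: (eqm_hom (f := fun g => fev r' (fev alp g)) (f' := fun g => r x * fev r' g * (r x)^-1)).
    + by apply: hom_comp; apply: fev_hom.
    + by move=> h h'; rewrite hr' !mulgA mulgVK.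
    + by move=> h; apply: ns_fev.
    + by move=> i'; rewrite !fevX; apply: alp_conj.
  rewrite invg1 mulg1 hr' fevX; case: ltnP => [lt_iB|le_Bi].
    by rewrite /r' modn_small // divn_small // ne_ix (leq_trans lt_iB le_BB').
  by rewrite r1B // /r' ltnn.
- have := IH ((fev r1 w)^-1 g); rewrite bijVK (homV hr) (homV hrx) (homV hr1) invgK.
  have S0w : S 0%N (fev rx w) by apply: ns_fev.
  by move=> /(nsV nS)/nsJ => /(_ nS _ S0w); rewrite /eqm; congr (S k _); gnorm.
- rewrite hr hrx hr1 bijM; apply: eqm_trans (IH _) _.
  have -> : fev r w * fev r w' * fev r' g * (fev rx w * fev rx w')^-1 =
      fev r w * (fev r w' * fev r' g * (fev rx w')^-1) * (fev rx w)^-1.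
    by rewrite invgM !mulgA.
  by apply: eqm_sandwich; [apply: ns_fev | apply: IH'].
Qed.

Lemma elim_back u : fev r1 v = transl u -> kill_deg B' elim_om k u -> S k (fev r v).
Proof.
move=> eu u_kill; have Su : S k (fev r' u).
  by apply: u_kill => // i le_i; rewrite /r' ltnNge le_i.
(* At g = 1 the factor [fev rx v] is trivial by [eps_v], so [fev r' u] and [fev r v] agree modulo S
   k. *)
have := transport v 1; rewrite eu translE !mulg1.
rewrite (fev_single (r x) eps_v) invg1 mulg1 => Sk.
by have := nsM nS Su Sk; rewrite mulVKg.
Qed.

End Back.

Lemma eliminate :
  exists u, comm_deg B' elim_om k u /\ (kill_deg B' elim_om k u -> kill_deg B om k v).
Proof.
have [u eu] := v_transl; exists u; split; first exact: u_comm.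
by move=> u_kill G S r nS Sr r1B; apply: (elim_back nS Sr r1B eu).
Qed.

End Eliminate.

Lemma kill_deg_large B om k v : (forall i, (i < B)%N -> (k <= om i)%N) -> kill_deg B om k v.
Proof.
move=> om_ge G S r nS Sr r1; apply: ns_fev => // i.
case: (ltnP i B) => [lt_iB|/r1 ->]; last exact: ns1.
by apply: ns_leq (Sr i lt_iB) => //; apply: om_ge.
Qed.

(** Lexicographic induction on k - m and on the number of letters of weight exactly m; once there
    are none, m is replaced by m + 1. *)
Lemma comm_deg_kill_deg m B om k v : (0 < m)%N -> (forall i, (i < B)%N -> (m <= om i)%N) ->
  comm_deg B om k v -> kill_deg B om k v.
Proof.
suff: forall d m B om v, (0 < m)%N -> (k <= m + d)%N ->
    (forall i, (i < B)%N -> (m <= om i)%N) -> comm_deg B om k v -> kill_deg B om k v.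
  by move=> H ? ?; apply: (H k m) => //; apply: leq_addl.
move=> {m B om v}; elim=> [|d IHd] m B om v m_gt0 le_k om_ge v_comm.
  by apply: kill_deg_large => i /om_ge; apply: leq_trans; rewrite -(addn0 m).
have [le_km|lt_mk] := leqP k m.
  by apply: kill_deg_large => i /om_ge; apply: leq_trans.
have [c] := ubnP (count (fun i => om i == m) (iota 0 B)).
elim: c B om v om_ge v_comm => // c IHc B om v om_ge v_comm.
case: (posnP (count (fun i => om i == m) (iota 0 B))) => [c0 _|c_gt0 lt_c].
  apply: (IHd m.+1) => //; first by rewrite addSnnS.
  move=> i lt_iB; rewrite ltn_neqAle om_ge // andbT eq_sym.
  move/eqP: c0; rewrite -leqn0 leqNgt -has_count => /hasPn -> //.
  by rewrite mem_iota.
move: c_gt0; rewrite -has_count => /hasP[x]; rewrite mem_iota add0n /= => lt_xB /eqP om_x.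
have [u [u_comm]] := eliminate m_gt0 lt_mk lt_xB om_x v_comm; apply.
apply: IHc u_comm _; first exact: (elim_om_ge lt_mk lt_xB).
rewrite -ltnS; apply: leq_trans lt_c; rewrite ltnS.
exact: (elim_om_count m_gt0 lt_mk lt_xB).
Qed.

(** * Combing braids *)

Section Combing.
Variables (G : groupType) (s : nat -> G).
Hypothesis far : forall i j, (i.+1 < j)%N -> commute (s i) (s j).
Hypothesis braid : forall i, s i * s i.+1 * s i = s i.+1 * s i * s i.+1.

Let braidV i : s i * s i.+1 * (s i)^-1 = (s i.+1)^-1 * s i * s i.+1.
Proof.
by apply: (@mulgI _ (s i.+1)); apply: (@mulIg _ (s i)); rewrite !mulgA mulgVK mulgV mul1g braid.
Qed.

Definition braids (n : nat) (p : G) := exists2 w, bword_in n w & p = ev s w.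

Lemma braids_gen n i : (i.+1 < n)%N -> braids n (s i).
Proof. by move=> lt_i; exists [:: (i, false)]; rewrite /= ?lt_i // mulg1. Qed.

Lemma ev_inv (w : word) : ev s (inv_word w) = (ev s w)^-1.
Proof. by rewrite -!fev_pi fgpi_inv (homV (fev_hom s)). Qed.

Lemma braids_subgrp n : subgrp (braids n).
Proof.
split=> [|_ _ [w Hw ->] [w' Hw' ->]|_ [w Hw ->]]; first by exists [::].
- by exists (w ++ w'); rewrite ?ev_cat // /bword_in all_cat; apply/andP.
- exists (inv_word w); last by rewrite ev_inv.
  by rewrite /bword_in all_rev all_map.
Qed.

Lemma braids_leq n n' p : (n <= n')%N -> braids n p -> braids n' p.
Proof.
move=> le_n [w Hw ->]; exists w => //; apply: sub_all Hw => i /= lt_i.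
exact: leq_trans le_n.
Qed.

Variable n : nat.

Fixpoint strand_fuel (d i : nat) : G :=
  if d is d'.+1 then s i * strand_fuel d' i.+1 * (s i)^-1 else (s i * s i)^-1.

(* Strand n runs once around strand i: the inverse of the standard generator A_(i, n). *)
Definition strand (i : nat) : G := strand_fuel (n.-1 - i) i.

Lemma strandS i : (i.+1 < n)%N -> strand i = s i * strand i.+1 * (s i)^-1.
Proof. by move=> lt_i; rewrite /strand (_ : n.-1 - i = (n.-1 - i.+1).+1)%N //; lia. Qed.

Lemma strand_last : (0 < n)%N -> strand n.-1 = (s n.-1 * s n.-1)^-1.
Proof. by rewrite /strand subnn. Qed.

Lemma strand_ind (P : nat -> Prop) : (forall i, i.+1 = n -> P i) ->
  (forall i, (i.+1 < n)%N -> P i.+1 -> P i) -> forall i, (i < n)%N -> P i.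
Proof.
move=> Pn PS i; have [d] := ubnP (n - i); elim: d i => // d IH i lt_d lt_i.
have [e|ne] := eqVneq i.+1 n; first exact: Pn.
by apply: PS; [lia | apply: IH; lia].
Qed.

Lemma strand_far_lt i l : (l.+1 < i)%N -> (i < n)%N -> commute (s l) (strand i).
Proof.
move=> lt_li lt_in; elim/strand_ind: i / lt_in lt_li => i.
  move=> e lt_li; have -> : i = n.-1 by lia.
  rewrite strand_last; last by lia.
  by apply/commuteV/commuteM; apply: far; lia.
move=> lt_i IH lt_li; rewrite strandS //.
apply: commuteM; last by apply: commuteV; apply: far; lia.
by apply: commuteM; [apply: far; lia | apply: IH; lia].
Qed.

Lemma strand_far_gt i l : (i < l)%N -> (l.+1 < n)%N -> commute (s l) (strand i).
Proof.
move=> lt_il lt_ln; have [d] := ubnP (l - i); elim: d i lt_il => // d IH i lt_il lt_d.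
rewrite (strandS (i := i)); last by lia.
have [e|ne] := eqVneq i.+1 l.
  rewrite e strandS // -e; have := @strand_far_lt i.+2 i (leqnn _) _.
  move: (strand i.+2) => a; rewrite e => /(_ lt_ln) ca; move: ca; rewrite -e => ca.
  apply: (@mulIg _ (s i * s i.+1)); rewrite /commute !mulgA.
  have e1 x : x / s i.+1 / s i * s i.+1 * s i * s i.+1 = x * s i.
    by rewrite -!mulgA (mulgA (s i.+1)) -braid -!mulgA mulKg mulKg.
  rewrite e1 (mulgVK (s i)) (mulgVK (s i.+1)) -braid.
  by rewrite -(mulgA _ (s i) a) ca !mulgA.
have ci : commute (s l) (s i) by apply/commute_sym/far; lia.
apply: commuteM; last exact: commuteV.
by apply: commuteM => //; apply: IH; lia.
Qed.

Let conj_strandS i : (i.+1 < n)%N -> (s i)^-1 * strand i * s i = strand i.+1.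
Proof. by move=> lt_i; rewrite strandS // !mulgA mulVg mul1g mulgVK. Qed.

(** With [strandS] and the two commutation lemmas, this shows that s i conjugates the strands by the
    formulas of the Artin action on the x_i. *)
Lemma conj_strand i : (i.+1 < n)%N ->
  s i * strand i * (s i)^-1 = strand i * strand i.+1 * (strand i)^-1.
Proof.
move=> lt_i; suff H j : (j < n)%N -> (0 < j)%N ->
    s j.-1 * strand j.-1 * (s j.-1)^-1 = strand j.-1 * strand j * (strand j.-1)^-1.
  exact: H i.+1 lt_i isT.
move=> lt_jn; elim/strand_ind: j / lt_jn => -[|{lt_i}i] //=.
  move=> e _; have lt_i : (i.+1 < n)%N by lia.
  have : strand n.-1 = (s n.-1 * s n.-1)^-1 by apply: strand_last; lia.
  rewrite -e /= (strandS lt_i) => ->.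
  set a := s i; set b := s i.+1.
  have c1 : commute b (a * b * b * a).
    rewrite /commute; transitivity (a * b * (a * b * a)); first by rewrite !mulgA -braid.
    by rewrite braid !mulgA.
  have c2 : commute (b * b) (a * b * b * a).
    by apply/commute_sym; apply: commuteM; apply: commute_sym.
  move: c2; rewrite !mulgA /commute -(mulgA a b b); move: (b * b) => u; rewrite !mulgA => c2.
  apply: (@mulgI _ (u * a * u * a^-1)).
  by rewrite !invgM !invgK !mulgA !mulgVK c2 ?(mulgK, mulgVK) mulgV mul1g.
move=> lt_i /(_ isT) /= IH _.
have lt_i' : (i.+1 < n)%N by lia.
(* Conjugation by Y lowers the indices i + 1 and i + 2 of strands by one, and turns s (i + 1) into s
   i: it carries the relation at i + 1 to the one at i. *)
pose Y := s i.+1 * s i.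
have Y1 : Y * s i.+1 * Y^-1 = s i.
  by rewrite /Y -braid invgM !mulgA mulgK mulgK.
have Y2 : Y * strand i.+2 * Y^-1 = strand i.+1.
  rewrite (strandS (i := i.+1)) // /Y -(mulgA (s i.+1)) (strand_far_lt (i := i.+2) (l := i)) //.
  by rewrite invgM !mulgA mulgK.
have Y3 : Y * strand i.+1 * Y^-1 = strand i.
  have -> : Y * strand i.+1 * Y^-1 = s i.+1 * (s i * strand i.+1 * (s i)^-1) * (s i.+1)^-1.
    by rewrite /Y; gnorm.
  rewrite -strandS //.
  by rewrite (strand_far_gt (i := i) (l := i.+1)) // mulgK.
have YM x y : Y * (x * y) * Y^-1 = (Y * x * Y^-1) * (Y * y * Y^-1) by gnorm.
have YV x : Y * x^-1 * Y^-1 = (Y * x * Y^-1)^-1 by gnorm.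
have := congr1 (fun x => Y * x * Y^-1) IH.
by rewrite !YM !YV Y1 Y2 Y3.
Qed.

Lemma conjV_strand i : (i.+1 < n)%N ->
  (s i)^-1 * strand i.+1 * s i = (strand i.+1)^-1 * strand i * strand i.+1.
Proof.
move=> lt_i; have := congr1 (fun x => (s i)^-1 * x * s i) (conj_strand lt_i).
have -> : (s i)^-1 * (s i * strand i * (s i)^-1) * s i = strand i by gnorm.
have -> : (s i)^-1 * (strand i * strand i.+1 * (strand i)^-1) * s i =
    ((s i)^-1 * strand i * s i) * ((s i)^-1 * strand i.+1 * s i)
    * ((s i)^-1 * strand i * s i)^-1 by gnorm.
by rewrite conj_strandS // => ->; gnorm.
Qed.

Definition strands : G -> Prop := gen (fun c => exists2 i, (i < n)%N & c = strand i).

Lemma strands_gen i : (i < n)%N -> strands (strand i).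
Proof. by move=> lt_i; apply: gen_base; exists i. Qed.

Lemma strands_subgrp : subgrp strands. Proof. exact: gen_subgrp. Qed.

Let strands_conj_min (p : G) : (forall i, (i < n)%N -> strands (p * strand i * p^-1)) ->
  forall c, strands c -> strands (p * c * p^-1).
Proof.
move=> Hp c; elim=> [_ [i lt_i ->]||g h _ Hg _ Hh|g _ Hg]; first exact: Hp.
- by rewrite mulg1 mulgV; apply: gen_1.
- have -> : p * (g * h) * p^-1 = (p * g * p^-1) * (p * h * p^-1) by gnorm.
  exact: gen_M.
- have -> : p * g^-1 * p^-1 = (p * g * p^-1)^-1 by gnorm.
  exact: gen_V.
Qed.

Lemma strands_normal p c : braids n p -> strands c -> strands (p * c * p^-1).
Proof.
move=> [w + ->]; elim: w c => [|[l b] w IH] c /=; first by rewrite mul1g invg1 mulg1.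
move=> /andP[lt_l /IH {}IH] /IH; move: (ev s w) => q {IH}.
rewrite invgM !mulgA -(mulgA (evl s _)) -(mulgA (evl s _)).
move: (q * c / q) => {q}c {w}; apply: strands_conj_min => i lt_i.
have sN := strands_subgrp.
have Cp x : commute (s l) x -> evl s (l, b) * x * (evl s (l, b))^-1 = x.
  move=> cx; rewrite /evl /=; case: b; last by rewrite cx mulgK.
  by rewrite invgK -mulgA -cx mulKg.
have [lt_li|le_il] := ltnP l i.
  have [e|ne] := eqVneq l.+1 i; last first.
    by rewrite Cp; [apply: strands_gen | apply: strand_far_lt => //; lia].
  rewrite -e /evl /= in lt_i lt_li *; case: b Cp => _.
    rewrite invgK conjV_strand //.
    by do ![apply: (sgM sN) | apply: (sgV sN)]; apply: strands_gen => //; apply: ltnW.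
  by rewrite -strandS //; apply: strands_gen; apply: ltnW.
have [e|ne] := eqVneq l i.
  rewrite e /evl /= in lt_l *; case: b Cp => _.
    by rewrite invgK conj_strandS //; apply: strands_gen.
  rewrite conj_strand //.
  by do ![apply: (sgM sN) | apply: (sgV sN)]; apply: strands_gen => //; apply: ltnW.
by rewrite Cp; [apply: strands_gen | apply: strand_far_gt => //; lia].
Qed.

Fixpoint pass_fuel (d k : nat) : G :=
  if d is d'.+1 then pass_fuel d' k.+1 * (s k)^-1 else 1.

(* Coset representatives: strand k is passed to the last position n. *)
Definition pass (k : nat) : G := pass_fuel (n - k) k.

Lemma pass_n : pass n = 1. Proof. by rewrite /pass subnn. Qed.

Lemma passS k : (k < n)%N -> pass k = pass k.+1 * (s k)^-1.
Proof. by move=> lt_k; rewrite /pass -subnSK. Qed.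

Lemma pass_ind (P : nat -> Prop) : P n ->
  (forall i, (i < n)%N -> P i.+1 -> P i) -> forall i, (i <= n)%N -> P i.
Proof.
move=> Pn PS i; have [d] := ubnP (n - i); elim: d i => // d IH i lt_d le_i.
have [-> //|ne] := eqVneq i n; have lt_i : (i < n)%N by lia.
by apply: PS => //; apply: IH; lia.
Qed.

Lemma pass_far l k : (l.+1 < k)%N -> (k <= n)%N -> commute (s l) (pass k).
Proof.
move=> lt_lk le_k; elim/pass_ind: k / le_k lt_lk => [_|i lt_i IH lt_lk].
  by rewrite pass_n; apply: commute1.
rewrite passS //; apply: commuteM; first by apply: IH; lia.
by apply: commuteV; apply: far.
Qed.

(** The second classical formula for the same loop: the inverse square of s k conjugated by the
    higher generators, instead of that of s (n - 1) conjugated by the lower ones. *)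
Lemma pass_strand k : (k < n)%N -> pass k.+1 * (s k * s k)^-1 * (pass k.+1)^-1 = strand k.
Proof.
move=> lt_k; elim/strand_ind: k / lt_k => k.
  move=> e; rewrite e pass_n mul1g invg1 mulg1.
  by rewrite (_ : k = n.-1) ?strand_last //; lia.
move=> lt_k IH; rewrite strandS // -IH (passS (k := k.+1)) //.
have c : commute (s k) (pass k.+2) by apply: pass_far.
move: (pass k.+2) c => t c.
have -> : s k * (t * (s k.+1 * s k.+1)^-1 * t^-1) * (s k)^-1 =
    t * (s k * (s k.+1 * s k.+1)^-1 * (s k)^-1) * t^-1.
  by rewrite !mulgA c -!mulgA; congr (_ * _); do 2 congr (_ * _);
     rewrite -!invgM c.
have -> : s k * (s k.+1 * s k.+1)^-1 * (s k)^-1 = (s k.+1)^-1 * (s k * s k)^-1 * s k.+1.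
  have -> : s k * (s k.+1 * s k.+1)^-1 * (s k)^-1 =
    (s k * s k.+1 * (s k)^-1 * (s k * s k.+1 * (s k)^-1))^-1 by gnorm.
  by rewrite braidV; gnorm.
by gnorm.
Qed.

Lemma pass_shift k l : (k <= l)%N -> (l.+1 < n)%N -> pass k * s l.+1 = s l * pass k.
Proof.
move=> le_kl lt_l; have [d] := ubnP (l - k); elim: d k le_kl => // d IH k le_kl lt_d.
rewrite passS; last by lia.
have [e|ne] := eqVneq k l.
  rewrite e passS // -mulgA -mulgA.
  have -> : (s l.+1)^-1 * ((s l)^-1 * s l.+1) = s l * (s l.+1)^-1 * (s l)^-1.
    apply: (@mulgI _ (s l * s l.+1)); apply: (@mulIg _ (s l)).
    by rewrite !mulgA mulgK mulgV mul1g mulgVK braid mulgK.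
  have c : commute (s l) (pass l.+2) by apply: pass_far.
  by rewrite !mulgA -c.
have c : commute (s l.+1) (s k) by apply/commute_sym/far; lia.
rewrite -mulgA -(commuteV c) mulgA IH ?mulgA //; lia.
Qed.

(** The products c p (pass k) are stable under right multiplication by letters. Only the letters s
    (k - 1), s k and their inverses change k; for two of these four a loop comes out and is carried
    left past p by normality. *)
Lemma comb w : bword_in n.+1 w ->
  exists c p k, [/\ strands c, braids n p, (k <= n)%N & ev s w = c * p * pass k].
Proof.
pose C b := exists c p k, [/\ strands c, braids n p, (k <= n)%N & b = c * p * pass k].
have sN := strands_subgrp; have sB := braids_subgrp n.
suff step b l e : (l < n)%N -> C b -> C (b * evl s (l, e)).
  suff: forall b, C b -> bword_in n.+1 w -> C (b * ev s w).
    move=> /(_ 1); rewrite mul1g; apply; exists 1, 1, n.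
    by split; [exact: sg1 | exact: sg1 | | rewrite pass_n !mulg1].
  elim: w => [|[l e] w IH] b Cb /=; first by rewrite mulg1.
  by move=> /andP[lt_l /IH H]; rewrite mulgA; apply: H; apply: step.
move=> lt_l [c [p [k [Nc Bp le_k ->]]]].
have absorb a q : strands a ->
    strands (c * (p * a * p^-1)) /\ c * (p * a * p^-1) * p * q = c * p * (a * q).
  by move=> Na; split; [apply: sgM => //; apply: strands_normal | gnorm].
have e_braids i : (i.+1 < n)%N -> braids n (evl s (i, e)).
  by move=> lt_i; rewrite /evl; case: ifP => _; [apply: (sgV sB) |]; apply: braids_gen.
have [lt_lk|le_kl] := ltnP l k.
  have [ek|ne] := eqVneq l.+1 k.
    have el : pass k = pass l * s l by rewrite (passS lt_l) ek mulgVK.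
    rewrite /evl; case: e {e_braids} => /=.
      by exists c, p, l; split=> //; rewrite ?(ltnW lt_l) // el !mulgA mulgK.
    have [Na ea] := absorb (strand l)^-1 (pass l) (sgV sN (strands_gen lt_l)).
    exists (c * (p * (strand l)^-1 * p^-1)), p, l; split=> //; first exact: ltnW.
    by rewrite ea -pass_strand // ek (passS lt_l) ek; gnorm.
  exists c, (p * evl s (l, e)), k; split=> //; first by apply: sgM => //; apply: e_braids; lia.
  have cl : commute (s l) (pass k) by apply: pass_far => //; lia.
  rewrite -!mulgA; congr (_ * (_ * _)); rewrite /evl /=; case: (e) => //.
  by symmetry; apply/commute_sym/commuteV/commute_sym.
have [ek|ne] := eqVneq k l.
  rewrite ek /evl; case: e {e_braids} => /=; last first.
    exists c, p, l.+1; split=> //.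
    by rewrite (passS lt_l) !mulgA mulgVK.
  have [Na ea] := absorb (strand l) (pass l.+1) (strands_gen lt_l).
  exists (c * (p * strand l * p^-1)), p, l.+1; split=> //.
  by rewrite ea -pass_strand // (passS lt_l); gnorm.
have [l' el] : exists l', l = l'.+1 by exists l.-1; lia.
rewrite el in lt_l le_kl ne *.
exists c, (p * evl s (l', e)), k; split=> //; first by apply: sgM => //; apply: e_braids.
have sh : pass k * s l'.+1 = s l' * pass k by apply: pass_shift => //; lia.
rewrite -!mulgA; congr (_ * (_ * _)); rewrite /evl /=; case: (e) => //.
by apply: (@mulgI _ (s l')); apply: (@mulIg _ (s l'.+1)); rewrite !mulgA mulgVK mulgV mul1g.
Qed.

End Combing.

(** * The Artin action *)

Definition sigX (i t : nat) : FG :=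
  if t == i then X i * X i.+1 * (X i)^-1 else if t == i.+1 then X i else X t.
Definition sigVX (i t : nat) : FG :=
  if t == i then X i.+1 else if t == i.+1 then (X i.+1)^-1 * X i * X i.+1 else X t.

Lemma fgpi_sigmaA i t : fgpi (sigmaA i t) = sigX i t.
Proof.
rewrite /sigmaA /sigX; case: eqP => _; last by case: eqP.
by rewrite (fgpi_cons _ [:: _; _]) (fgpi_cons _ [:: _]) !fgpi_letter mulgA.
Qed.

Lemma fgpi_sigmaAinv i t : fgpi (sigmaAinv i t) = sigVX i t.
Proof.
rewrite /sigmaAinv /sigVX; case: eqP => _ //; case: eqP => _ //.
by rewrite (fgpi_cons _ [:: _; _]) (fgpi_cons _ [:: _]) !fgpi_letter mulgA.
Qed.

Lemma sig_subproof i : cancel (fev (sigX i)) (fev (sigVX i)).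
Proof.
move=> g; apply: (hom_ext (hom_comp (fev_hom _) (fev_hom _))) => // t; rewrite fevX /sigX.
have hV := fev_hom (sigVX i).
case: eqP => [->|ne]; last case: eqP => [->|ne'].
- by rewrite !hV (homV hV) !fevX /sigVX eqxx gtn_eqF // eqxx !mulgA mulgV mul1g mulgK.
- by rewrite fevX /sigVX eqxx.
- by rewrite fevX /sigVX; case: eqP => // _; case: eqP.
Qed.

Lemma sigV_subproof i : cancel (fev (sigVX i)) (fev (sigX i)).
Proof.
move=> g; apply: (hom_ext (hom_comp (fev_hom _) (fev_hom _))) => // t; rewrite fevX /sigVX.
have hV := fev_hom (sigX i).
case: eqP => [->|ne]; last case: eqP => [->|ne'].
- by rewrite fevX /sigX gtn_eqF // eqxx.
- by rewrite !hV (homV hV) !fevX /sigX eqxx gtn_eqF // eqxx !mulgA mulVg mul1g mulgVK.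
- by rewrite fevX /sigX; case: eqP => // _; case: eqP.
Qed.

Definition sig i : bij FG := MkBij (sig_subproof i) (sigV_subproof i).

Lemma sig_hom i : ishom (sig i). Proof. exact: fev_hom. Qed.
Lemma sigV_hom i : ishom (sig i)^-1. Proof. exact: fev_hom. Qed.

Lemma sigE i t : sig i (X t) = sigX i t. Proof. exact: fevX. Qed.
Lemma sigVE i t : (sig i)^-1 (X t) = sigVX i t. Proof. exact: fevX. Qed.

Lemma sig_l i : sig i (X i) = X i * X i.+1 * (X i)^-1.
Proof. by rewrite sigE /sigX eqxx. Qed.
Lemma sig_r i : sig i (X i.+1) = X i.
Proof. by rewrite sigE /sigX gtn_eqF // eqxx. Qed.
Lemma sig_id i t : t != i -> t != i.+1 -> sig i (X t) = X t.
Proof. by rewrite sigE /sigX => /negbTE -> /negbTE ->. Qed.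
Lemma sigV_l i : (sig i)^-1 (X i) = X i.+1.
Proof. by rewrite sigVE /sigVX eqxx. Qed.
Lemma sigV_r i : (sig i)^-1 (X i.+1) = (X i) ^ (X i.+1).
Proof. by rewrite sigVE /sigVX gtn_eqF // eqxx /conjg mulgA. Qed.
Lemma sigV_id i t : t != i -> t != i.+1 -> (sig i)^-1 (X t) = X t.
Proof. by rewrite sigVE /sigVX => /negbTE -> /negbTE ->. Qed.

Lemma sig_far i j : (i.+1 < j)%N -> commute (sig i) (sig j).
Proof.
move=> lt_ij; have hi := sig_hom i; have hj := sig_hom j.
apply: bij_hom_ext => [||t]; try exact: hom_bijM.
rewrite !bijM.
have [->|t_i] := eqVneq t i.
  by rewrite (@sig_id j i) ?sig_l ?hj ?(homV hj) ?sig_id //; lia.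
have [->|t_i1] := eqVneq t i.+1.
  by rewrite (@sig_id j i.+1) ?sig_r ?sig_id //; lia.
rewrite (@sig_id i t) //; have [->|t_j] := eqVneq t j.
  by rewrite sig_l !hi (homV hi) !sig_id //; lia.
have [->|t_j1] := eqVneq t j.+1; first by rewrite sig_r sig_id //; lia.
by rewrite !sig_id.
Qed.

Lemma braid_letters (G : groupType) (f g : G -> G) (x y z : G) : ishom f -> ishom g ->
  f x = x * y * x^-1 -> f y = x -> f z = z ->
  g x = x -> g y = y * z * y^-1 -> g z = y ->
  f (g (f x)) = g (f (g x)) /\ f (g (f y)) = g (f (g y)).
Proof.
move=> hf hg fx fy fz gx gy gz; pose E := (fx, fy, fz, gx, gy, gz, homV hf, homV hg, hf, hg).
by split; rewrite !E; gnorm.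
Qed.

Lemma sig_braid i : sig i * sig i.+1 * sig i = sig i.+1 * sig i * sig i.+1.
Proof.
have hi := sig_hom i; have hj := sig_hom i.+1.
apply: bij_hom_ext => [||t]; try by do ![apply: hom_bijM].
rewrite !bijM.
have e : sig i (X i.+2) = X i.+2 by apply: sig_id; lia.
have e' : sig i.+1 (X i) = X i by apply: sig_id; lia.
have [e1 e2] := braid_letters hi hj (sig_l i) (sig_r i) e e' (sig_l i.+1) (sig_r i.+1).
have [->|t_i] := eqVneq t i; first exact: e1.
have [->|t_i1] := eqVneq t i.+1; first exact: e2.
have [->|t_i2] := eqVneq t i.+2; first by rewrite e !sig_r e'.
by rewrite !sig_id.
Qed.

Definition artinB : word -> bij FG := ev sig.

Lemma artinB_cons l w : artinB (l :: w) = evl sig l * artinB w.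
Proof. by []. Qed.

Lemma artinB_hom w : ishom (artinB w).
Proof.
elim: w => [|[i b] w IH]; first exact: hom_bij1.
by apply: hom_bijM => //; case: b; [apply: sigV_hom | apply: sig_hom].
Qed.

Lemma braids_hom n b : braids sig n b -> ishom b.
Proof. by case=> w _ ->; apply: artinB_hom. Qed.

Lemma sig_conj i b t : exists g, evl sig (i, b) (X t) = X (transp i t) ^ g.
Proof.
rewrite /evl /transp /=; case: b; rewrite ?sigVE ?sigE /sigX /sigVX.
  case: eqP => [_|_]; first by exists 1; rewrite conjg1.
  case: eqP => [_|_]; last by exists 1; rewrite conjg1.
  by exists (X i.+1); rewrite /conjg mulgA.
case: eqP => [_|_]; first by exists (X i)^-1; rewrite /conjg invgK mulgA.
by case: eqP => [_|_]; exists 1; rewrite conjg1.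
Qed.

Lemma homJ (G H : groupType) (f : G -> H) x y : ishom f -> f (x ^ y) = f x ^ f y.
Proof. by move=> hf; rewrite /conjg !hf (homV hf). Qed.

Lemma artinB_conj w t : exists g, artinB w (X t) = X (bperm w t) ^ g.
Proof.
elim: w => [|[i b] w [g IH]]; first by exists 1; rewrite conjg1.
rewrite artinB_cons bijM IH homJ; last by case: b; [apply: sigV_hom | apply: sig_hom].
by have [h ->] := sig_conj i b (bperm w t); eexists; rewrite -conjgM.
Qed.

(** Trivial action on the abelianisation; by [IAB_artin], a braid has this property exactly when it
    is pure. *)
Definition IAB (b : bij FG) : Prop := ishom b /\ forall u g, eps u (b g) = eps u g.

Lemma eps_ext (f f' : FG -> FG) u : ishom f -> ishom f' ->
  (forall t, eps u (f (X t)) = eps u (f' (X t))) -> forall g, eps u (f g) = eps u (f' g).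
Proof.
move=> hf hf' e; elim/fg_ind => [|//|g IH|g h IHg IHh].
- by rewrite !hom1.
- by rewrite !homV // !epsV IH.
- by rewrite hf hf' !epsM IHg IHh.
Qed.

Lemma IAB_subgrp : subgrp IAB.
Proof.
split=> [|b c [hb Eb] [hc Ec]|b [hb Eb]]; first by split.
- by split; [apply: hom_bijM | move=> u g; rewrite bijM Eb Ec].
- by split; [apply: hom_bijV | move=> u g; rewrite -Eb bijVK].
Qed.

Lemma IAB_artin w : IAB (artinB w) <-> forall t, bperm w t = t.
Proof.
split=> [[_ Ew] t|pw].
  have [g e] := artinB_conj w t; have := Ew t (X t).
  by rewrite e eps_conj !epsX eqxx; case: eqP.
have hw := artinB_hom w; split=> // u; apply: (eps_ext (f' := id)) => // t.
by have [g ->] := artinB_conj w t; rewrite eps_conj pw.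
Qed.

Definition PB n b := braids sig n b /\ IAB b.

Lemma PB_subgrp n : subgrp (PB n).
Proof.
have sB := braids_subgrp sig n; have sI := IAB_subgrp.
split=> [|b c [Bb Ib] [Bc Ic]|b [Bb Ib]]; split.
- exact: sg1. - exact: sg1. - exact: sgM. - exact: sgM. - exact: sgV. - exact: sgV.
Qed.

Lemma PB_leq n n' b : (n <= n')%N -> PB n b -> PB n' b.
Proof. by move=> le_n [Bb Ib]; split=> //; apply: braids_leq Bb. Qed.

Lemma transpK i : involutive (transp i).
Proof. by move=> t; rewrite /transp; do !case: eqP => //; lia. Qed.

Lemma eps_sig i b u g : eps u (evl sig (i, b) g) = eps (transp i u) g.
Proof.
have hs : ishom (evl sig (i, b)) by case: b; [apply: sigV_hom | apply: sig_hom].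
elim/fg_ind: g => [|t|g IH|g h IHg IHh].
- by rewrite (hom1 hs).
- have [g ->] := sig_conj i b t; rewrite eps_conj !epsX.
  by rewrite -(inj_eq (inv_inj (transpK i))) transpK.
- by rewrite (homV hs) !epsV IH.
- by rewrite hs !epsM IHg IHh.
Qed.

Lemma IAB_conj_sig i b : IAB b -> IAB (sig i * b * (sig i)^-1).
Proof.
move=> [hb Eb]; split; first by do ![apply: hom_bijM => //]; [apply: sig_hom | apply: sigV_hom].
move=> u g; rewrite !bijM (eps_sig i false) Eb (eps_sig i true).
by rewrite transpK.
Qed.

Lemma IAB_sig2 i : IAB (sig i * sig i)^-1.
Proof.
apply: (sgV IAB_subgrp); split; first by apply: hom_bijM; apply: sig_hom.
by move=> u g; rewrite bijM !(eps_sig i false) transpK.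
Qed.

(** * The loops of strand n acting on the free group *)

Section Strands.
Variable n : nat.

Lemma strand_PB i : (i < n)%N -> PB n.+1 (strand sig n i).
Proof.
have sB := braids_subgrp sig n.+1.
move=> lt_i; elim/strand_ind: i / lt_i => i.
  move=> e; have -> : i = n.-1 by lia.
  have lt_n : (n.-1.+1 < n.+1)%N by lia.
  rewrite strand_last; last by lia.
  split; last exact: IAB_sig2.
  by apply: (sgV sB); apply: (sgM sB); apply: braids_gen.
move=> lt_i [Ba Ia]; rewrite strandS //; split; last exact: IAB_conj_sig.
have Bs : braids sig n.+1 (sig i) by apply: braids_gen; apply: ltnW.
by apply: (sgM sB); [apply: (sgM sB) | apply: (sgV sB)].
Qed.

(** The retraction onto F_n; on P_(n+1) it corresponds to forgetting strand n. *)
Definition kill (g : FG) : FG := fev (fun i => if (i < n)%N then X i else 1) g.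

Lemma kill_hom : ishom kill. Proof. exact: fev_hom. Qed.

Lemma killX i : kill (X i) = if (i < n)%N then X i else 1. Proof. exact: fevX. Qed.

Lemma kill_sig l g : (l.+1 < n)%N -> kill (sig l g) = sig l (kill g).
Proof.
move=> lt_l; have hk := kill_hom; have hs := sig_hom l.
apply: (hom_ext (hom_comp hk hs) (hom_comp hs hk)) => t; rewrite killX.
have [->|t_l] := eqVneq t l.
  by rewrite sig_l !hk (homV hk) !killX lt_l (ltnW lt_l) sig_l.
have [->|t_l1] := eqVneq t l.+1; first by rewrite sig_r killX lt_l (ltnW lt_l) sig_r.
by rewrite sig_id // killX; case: ifP => _; rewrite ?sig_id // (hom1 hs).
Qed.

Lemma kill_braids p g : braids sig n p -> kill (p g) = p (kill g).
Proof.
case=> w + ->; rewrite -/(artinB w); elim: w g => [|[l b] w IH] g //.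
rewrite artinB_cons => /andP[/= lt_l /IH {}IH].
rewrite -IH /evl; case: b => /=; last exact: kill_sig.
by apply: (can_inj (bijK (sig l))); rewrite -kill_sig // !bijVK.
Qed.

Lemma braids_fix p t : braids sig n p -> (n <= t)%N -> p (X t) = X t.
Proof.
case=> w + -> le_t; rewrite -/(artinB w); elim: w => [|[l b] w IH] //.
rewrite artinB_cons => /andP[/= lt_l /IH {}IH].
by rewrite IH /evl; case: b; [apply: sigV_id | apply: sig_id] => /=; lia.
Qed.

(** Here the inverse in [strand] pays off: for i + 1 = n, applying the inverse of [sig i] twice
    conjugates X n by X i ^ X n, which is X i and not its inverse once X n is killed. Conjugation by
    [sig i] then reaches the lower strands. *)
Lemma strand_kill i : (i < n)%N ->
  (forall g, kill (strand sig n i g) = kill g) /\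
  (exists2 w, strand sig n i (X n) = X n ^ w & kill w = X i).
Proof.
have hk := kill_hom.
move=> lt_i; elim/strand_ind: i / lt_i => i.
  move=> e; have -> : strand sig n i = (sig i)^-1 * (sig i)^-1.
    by rewrite -invgM (_ : i = n.-1) ?strand_last //; lia.
  have hV := sigV_hom i; split.
    apply: hom_ext => // [|t]; first by apply: hom_comp => //; apply: hom_bijM.
    rewrite bijM.
    have [->|t_i] := eqVneq t i.
      by rewrite sigV_l sigV_r homJ // e !killX ltnn /= -e ltnSn conjg1.
    have [->|t_i1] := eqVneq t i.+1; last by rewrite !sigV_id.
    by rewrite sigV_r homJ // sigV_l sigV_r homJ // e !killX ltnn conj1g.
  exists (X i ^ X n); last by rewrite homJ // !killX ltnn conjg1 -e ltnSn.
  by rewrite -e bijM sigV_r homJ // sigV_l sigV_r.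
move=> lt_i [IHk [w ew kw]]; rewrite strandS //; split.
  by move=> g; rewrite !bijM kill_sig // IHk -kill_sig // bijVK.
have hs := sig_hom i; exists (sig i w).
  rewrite !bijM sigV_id ?ew; try lia.
  by rewrite homJ // sig_id //; lia.
by rewrite kill_sig // kw sig_r.
Qed.

Definition strand_map : FG -> bij FG := fev (fun i => if (i < n)%N then strand sig n i else 1).

Lemma strand_map_hom : ishom strand_map. Proof. exact: fev_hom. Qed.

Lemma strands_map c : strands sig n c -> exists v, c = strand_map v.
Proof.
have hm := strand_map_hom.
elim=> [_ [i lt_i ->]||g h _ [v ->] _ [v' ->]|g _ [v ->]].
- by exists (X i); rewrite /strand_map fevX lt_i.
- by exists 1; rewrite (hom1 hm).
- by exists (v * v'); rewrite hm.
- by exists v^-1; rewrite (homV hm).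
Qed.

Lemma strand_map_PB v : PB n.+1 (strand_map v).
Proof.
have sP := PB_subgrp n.+1; have hm := strand_map_hom.
elim/fg_ind: v => [|i|g Hg|g h Hg Hh]; rewrite ?(hom1 hm) ?(homV hm) ?hm.
- exact: sg1.
- rewrite /strand_map fevX; case: ifP => lt_i; [exact: strand_PB | exact: sg1].
- exact: sgV.
- exact: sgM.
Qed.

Lemma kill_strand_map v g : kill (strand_map v g) = kill g.
Proof.
have hm := strand_map_hom.
elim/fg_ind: v g => [|i|v Hv|v v' Hv Hv'] g; rewrite ?(hom1 hm) ?(homV hm) ?hm //.
- rewrite /strand_map fevX; case: ifP => // lt_i; exact: (strand_kill lt_i).1.
- by rewrite -Hv bijVK.
- by rewrite bijM Hv Hv'.
Qed.

(** The conjugating words compose with a twist, w * strand_map v w', but [kill_strand_map] makes the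
    twist disappear under [kill]. *)
Lemma strand_map_last v : exists2 w, strand_map v (X n) = X n ^ w & kill w = kill v.
Proof.
have hm := strand_map_hom; have hk := kill_hom.
have hv v' : ishom (strand_map v') by case: (strand_map_PB v') => /braids_hom.
elim/fg_ind: v => [|i|v [w ew kw]|v v' [w ew kw] [w' ew' kw']].
- by exists 1; rewrite // (hom1 hm) conjg1.
- rewrite killX /strand_map fevX; case: ifP => lt_i; last first.
    by exists 1; rewrite ?conjg1 ?(hom1 hk).
  by case: (strand_kill lt_i).
- exists ((strand_map v)^-1 w)^-1.
    rewrite (homV hm); apply: (can_inj (bijK (strand_map v))); rewrite bijVK homJ //.
    by rewrite (homV (hv v)) bijVK ew conjgK.
  by rewrite !(homV hk) -kw -(kill_strand_map v) bijVK.
exists (w * strand_map v w'); last by rewrite !hk kill_strand_map kw kw'.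
by rewrite hm bijM ew' homJ // ew -conjgM.
Qed.

Lemma strand_map_kill v : strand_map (kill v) = strand_map v.
Proof.
apply: (hom_ext (hom_comp strand_map_hom kill_hom) strand_map_hom) => i.
rewrite killX; case: ifP => // nlt; rewrite (hom1 strand_map_hom) /strand_map fevX nlt //.
Qed.

Lemma pass_first k : (k <= n)%N -> pass sig n k (X k) = X n.
Proof.
move=> le_k; elim/pass_ind: k / le_k => [|k lt_k IH]; first by rewrite pass_n.
by rewrite passS // bijM sigV_l.
Qed.

End Strands.

(** * The Andreadakis filtration on pure braids *)

Notation lcF := (lcs (fun _ : FG => True)).

Lemma lcF_nseries : nseries lcF. Proof. exact: lcs_nseries. Qed.

Definition AjB j (b : bij FG) : Prop := forall g, lcF j.+1 (b g * g^-1).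

Lemma AjB_gen j (b : bij FG) : ishom b -> (forall i, lcF j.+1 (b (X i) * (X i)^-1)) -> AjB j b.
Proof.
move=> hb bX g; have nS := ns_shift lcF_nseries j hb.
suff [] : lcF 1 g /\ lcF (1 + j) (b g * g^-1) by [].
elim/fg_ind: g => [|i|g|g h].
- exact: (ns1 nS 1%N).
- by split.
- exact: (nsV nS (k := 1%N)).
- exact: (nsM nS (k := 1%N)).
Qed.

Lemma AjB_subgrp j : subgrp (AjB j).
Proof.
have sL := lcs_subgrp (subgrpT FG) j.+1.
split=> [g|b c Ab Ac g|b Ab g].
- by rewrite mulgV; apply: (sg1 sL).
- rewrite bijM; have := sgM sL (Ab (c g)) (Ac g).
  by rewrite !mulgA mulgVK.
have := sgV sL (Ab (b^-1 g)); by rewrite bijVK invgM invgK.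
Qed.

Lemma PB_AjB_lcs n j b : (0 < j)%N -> PB n b -> AjB j b -> lcs (PB n) j b.
Proof.
case: j => // j _; elim: n b => [|n IH] b.
  move=> [[[|[i e] w] //= _ ->] _] _; exact: (sg1 (lcs_subgrp (PB_subgrp 0) j.+1)).
move=> [[w Hw ew] Ib] Ab.
have [c [p [k [Nc Bp le_k]]]] := comb sig_far sig_braid Hw; rewrite -ew => eb.
have [v ec] := strands_map Nc; rewrite {}ec {c Nc} in eb.
have hk := kill_hom n; have hL := lcF_nseries.
have Pv := strand_map_PB n v; have [w0 e0 k0] := strand_map_last n v.
(* b preserves exponent sums and sends X k to a conjugate of X n. *)
have en : k = n.
  have := Ib.2 n (X k); rewrite eb !bijM pass_first // (braids_fix Bp) // e0 eps_conj.
  by rewrite !epsX eqxx; case: eqP.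
rewrite en pass_n mulg1 {en le_k k} in eb.
have Pp : PB n p.
  split=> //; have -> : p = (strand_map n v)^-1 * b by rewrite eb mulKg.
  by apply: sgM IAB_subgrp _ _ _ _ => //; apply: (sgV IAB_subgrp); case: Pv.
have Ap : AjB j.+1 p.
  apply: AjB_gen; first exact: braids_hom Bp.
  move=> i; case: (ltnP i n) => [lt_i|le_i]; last first.
    by rewrite (braids_fix Bp) // mulgV; apply: (ns1 hL).
  have := lcs_hom (H' := fun _ => True) hk (fun _ => id) (Ab (X i)).
  rewrite eb bijM hk (homV hk) kill_strand_map (kill_braids _ Bp) killX lt_i //.
have sP := lcs_subgrp (PB_subgrp n.+1) j.+1.
rewrite eb; apply: (sgM sP); last first.
  by apply: lcs_mono (IH _ Pp Ap) => h; apply: PB_leq.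
have Av : AjB j.+1 (strand_map n v).
  have -> : strand_map n v = b * p^-1 by rewrite eb mulgK.
  by have sA := AjB_subgrp j.+1; apply: (sgM sA) => //; apply: (sgV sA).
have w_comm : lcF j.+2 [~ w0, X n].
  have := Av (X n); rewrite e0 => Lw.
  have -> : [~ w0, X n] = ((X n ^ w0 * (X n)^-1) ^ X n)^-1 by gnorm.
  by apply: (nsV hL); apply: (nsJ hL).
(* All weights are 1, so any test map sends [FG] into S 1, and minimality of the lower central
   series transports [w_comm]. *)
have w_kill : kill_deg n (fun=> 1%N) j.+1 w0.
  apply: (@comm_deg_kill_deg 1) => // G S r t nS Sr rt St.
  have hr := fev_hom r.
  have -> : [~ fev r w0, t] = fev r [~ w0, X n] by rewrite (homR hr) fevX rt.
  apply: (lcs_min nS hr _ w_comm) => h _; apply: ns_fev => // i.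
  by case: (ltnP i n) => [/Sr //|/rt ->].
(* The test series is [lcF] itself, with the letters from n on sent to 1: that evaluation is
   [kill n]. *)
have Lw : lcF j.+1 (kill n v).
  rewrite -k0; apply: w_kill => //.
  by move=> i; rewrite leqNgt => /negbTE ->.
(* [strand_map] takes values in P_(n+1), hence maps the lower central series of [FG] into that of
   P_(n+1). *)
rewrite -strand_map_kill; apply: lcs_hom Lw; first exact: strand_map_hom.
by move=> h _; apply: strand_map_PB.
Qed.

(** The first letter occurs inverted further on; deleting the pair costs a commutator and shortens
    the word. *)
Lemma lcF_abelianization g : (forall i, eps i g = 0%R) -> lcF 2 g.
Proof.
rewrite -(fgpi_val g); move: (fgw g) => w eps_w.
have {eps_w} : forall i, epsw i w = 0%R by move=> i; rewrite -eps_pi.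
have hL := lcF_nseries.
have [m] := ubnP (size w); elim: m w => // m IH [|l w] lt_m eps_w; first exact: (ns1 hL).
have : inv_letter l \in w.
  have := eps_w l.1; rewrite -has_pred1 has_count /epsw; case: l {lt_m eps_w} => i b /=.
  by rewrite /inv_letter !xpair_eqE !eqxx /=; case: b => /=; lia.
move=> l_w; case/splitPr: l_w lt_m eps_w => u v lt_m eps_w.
rewrite -cat1s fgpi_cat fgpi_cat (fgpi_cons (inv_letter l)).
have -> : fgpi [:: inv_letter l] = (fgpi [:: l])^-1 by rewrite -fgpi_inv.
have -> : fgpi [:: l] * (fgpi u * ((fgpi [:: l])^-1 * fgpi v)) =
    [~ (fgpi [:: l])^-1, (fgpi u)^-1] * fgpi (u ++ v) by rewrite fgpi_cat; gnorm.
apply: (nsM hL); first by apply: (lcsR1 (subgrpT FG) (k := 1)).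
apply: IH; first by move: lt_m; rewrite /= !size_cat /=; lia.
move=> i; have := eps_w i; rewrite -cat1s epsw_cat epsw_cat (epsw_cons _ (inv_letter l)) epsw_cat.
by rewrite -[[:: inv_letter l]]/(inv_word [:: l]) epsw_inv; lia.
Qed.

(** * F_n as the words in the first n letters *)

Section Words.
Variable n : nat.

Lemma word_in_cat u v : word_in n (u ++ v) = word_in n u && word_in n v.
Proof. exact: all_cat. Qed.

Lemma word_in_inv u : word_in n (inv_word u) = word_in n u.
Proof. by rewrite /word_in /inv_word all_rev all_map. Qed.

Lemma word_in_comm u v : word_in n u -> word_in n v -> word_in n (commW u v).
Proof. by move=> Hu Hv; rewrite /commW !word_in_cat !word_in_inv Hu Hv. Qed.

Lemma word_in_subst f w : is_end n f -> word_in n w -> word_in n (subst f w).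
Proof.
move=> Hf; elim: w => //= l w IH /andP[lt_l /IH Hw].
rewrite [subst f _]/= word_in_cat Hw andbT; case: ifP => _; rewrite ?word_in_inv; exact: Hf.
Qed.

Lemma kill_fgpi w : kill n (fgpi w) = fgpi (filter (fun l => l.1 < n)%N w).
Proof.
rewrite /kill fev_pi; elim: w => //= -[i b] w IH; rewrite IH /evl /=; case: (i < n)%N.
  by rewrite (fgpi_cons (i, b)) fgpi_letter.
by case: b; rewrite ?invg1 mul1g.
Qed.

Lemma kill_word_in w : word_in n w -> kill n (fgpi w) = fgpi w.
Proof. by move=> /all_filterP e; rewrite kill_fgpi e. Qed.

Lemma kill_word g : exists2 w, word_in n w & kill n g = fgpi w.
Proof.
by exists (filter (fun l => l.1 < n)%N (fgw g)); [exact: filter_all | rewrite -kill_fgpi fgpi_val].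
Qed.

Lemma lcsF_lcF k w : lcsF n k w -> word_in n w /\ lcF k (fgpi w).
Proof.
elim: k w => [|[|k] IH] w //.
elim=> [u Hu [a [b [/IH[Ha La] [Hb ->]]]]||u v _ [Hu Lu] _ [Hv Lv]|u _ [Hu Lu]|u v _ [_ Lu] Hv].
- split; first exact: word_in_comm.
  by rewrite fgpi_comm; apply: gen_base; exists (fgpi a), (fgpi b).
- by split=> //; apply: gen_1.
- by rewrite word_in_cat Hu Hv fgpi_cat; split=> //; apply: gen_M.
- by rewrite word_in_inv fgpi_inv; split=> //; apply: gen_V.
- by move=> /weqP <-.
Qed.

(** Commutators in [FG] may involve letters beyond n; the retraction [kill n] replaces their entries
    by words of F_n. *)
Lemma lcF_lcsF k g w : lcF k g -> word_in n w -> fgpi w = kill n g -> lcsF n k w.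
Proof.
elim: k g w => [|[|k] IH] g w //= Lg Hw ew.
have hk := kill_hom n.
suff [u Lu eu] : exists2 u, lcsF n k.+2 u & fgpi u = kill n g.
  by apply: genW_eq Lu Hw _; apply/weqP; rewrite eu ew.
elim: Lg => [_ [a [b [La _ ->]]]||g1 g2 _ [u1 L1 e1] _ [u2 L2 e2]|g1 _ [u1 L1 e1]].
- have [u Hu eu] := kill_word a; have [v Hv ev] := kill_word b.
  exists (commW u v); last by rewrite fgpi_comm (homR hk) eu ev.
  apply: genW_base; first exact: word_in_comm.
  by exists u, v; split; first exact: IH La Hu (esym eu).
- by exists [::]; [apply: genW_nil | rewrite (hom1 hk)].
- by exists (u1 ++ u2); [apply: genW_cat | rewrite fgpi_cat hk e1 e2].
- by exists (inv_word u1); [apply: genW_inv | rewrite fgpi_inv (homV hk) e1].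
Qed.

(** * Endomorphisms given by words as bijections of the free group *)

(** Fixing the letters from n on makes b unique and lets products of bijections represent
    compositions. *)
Definition rep (f : End) (b : bij FG) : Prop :=
  ishom b /\ forall i, b (X i) = if (i < n)%N then fgpi (f i) else X i.

Lemma rep_uniq f b c : rep f b -> rep f c -> b = c.
Proof. by move=> [hb eb] [hc ec]; apply: bij_hom_ext => // i; rewrite eb ec. Qed.

Lemma rep_word f b w : rep f b -> word_in n w -> b (fgpi w) = fgpi (subst f w).
Proof.
move=> [hb eb]; elim: w => [|[i e] w IH] /=; first by rewrite fgpi_nil (hom1 hb).
move=> /andP[/= lt_i /IH {}IH]; rewrite fgpi_cons hb IH fgpi_letter [subst f (_ :: w)]/= fgpi_cat.
by congr (_ * _); case: e; rewrite /= ?(homV hb) eb lt_i // fgpi_inv.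
Qed.

Lemma rep_comp f g b c : is_end n g -> rep f b -> rep g c -> rep (Defs.comp f g) (b * c).
Proof.
move=> Hg Rf [hc ec]; split; first by apply: hom_bijM => //; case: Rf.
move=> i; rewrite bijM ec; case: ifP => lt_i; first by rewrite (rep_word Rf) //; apply: Hg.
by rewrite Rf.2 lt_i.
Qed.

Lemma rep_id : rep idE 1.
Proof. by split=> // i; rewrite bij1; case: ifP. Qed.

Lemma rep_eeq f g b : eeq n f g -> rep f b -> rep g b.
Proof.
move=> efg [hb eb]; split=> // i; rewrite eb; case: ifP => // lt_i.
by apply/weqP; apply: efg.
Qed.

Lemma rep_inverse f g b : rep f b -> Defs.inverse n f g -> rep g b^-1.
Proof.
move=> Rf [Hg [efg _]]; split; first by apply: hom_bijV; case: Rf.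
move=> i; apply: (can_inj (bijK b)); rewrite bijVK; case: ifP => lt_i.
  by rewrite (rep_word Rf (Hg i lt_i)); apply/esym/weqP; apply: efg.
by rewrite Rf.2 lt_i.
Qed.

Lemma inverse_rep f g b : is_end n f -> is_end n g -> rep f b -> rep g b^-1 -> Defs.inverse n f g.
Proof.
move=> Hf Hg Rf Rg; split=> //; split=> i lt_i; apply/weqP.
  by rewrite -(rep_word Rf (Hg i lt_i)); have := Rg.2 i; rewrite lt_i => <-; rewrite bijVK.
by rewrite -(rep_word Rg (Hf i lt_i)); have := Rf.2 i; rewrite lt_i => <-; rewrite bijK.
Qed.

Definition autrep (f : End) (b : bij FG) : Prop :=
  [/\ is_end n f, rep f b & exists2 g, is_end n g & rep g b^-1].

Lemma is_end_comp f g : is_end n f -> is_end n g -> is_end n (Defs.comp f g).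
Proof. by move=> Hf Hg i lt_i; apply: word_in_subst => //; apply: Hg. Qed.

Lemma is_end_id : is_end n idE.
Proof. by move=> i lt_i; rewrite /idE /= lt_i. Qed.

Lemma autrep_is_aut f b : autrep f b -> is_aut n f.
Proof. by case=> Hf Rf [g Hg Rg]; split=> //; exists g; apply: inverse_rep Rf Rg. Qed.

Lemma autrep_comp f g b c : autrep f b -> autrep g c -> autrep (Defs.comp f g) (b * c).
Proof.
move=> [Hf Rf [f' Hf' Rf']] [Hg Rg [g' Hg' Rg']]; split.
- exact: is_end_comp.
- exact: rep_comp.
- by exists (Defs.comp g' f'); [apply: is_end_comp | rewrite invgM; apply: rep_comp].
Qed.

Lemma autrep_id : autrep idE 1.
Proof.
split; [exact: is_end_id | exact: rep_id | exists idE; first exact: is_end_id].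
by rewrite invg1; apply: rep_id.
Qed.

Lemma autrep_inv f g b : autrep f b -> is_end n g -> rep g b^-1 -> autrep g b^-1.
Proof. by case=> Hf Rf _ Hg Rg; split=> //; exists f => //; rewrite invgK. Qed.

Lemma autrep_eeq f g b : eeq n f g -> is_end n g -> autrep f b -> autrep g b.
Proof. by move=> efg Hg [Hf Rf E]; split=> //; apply: rep_eeq Rf. Qed.

Lemma is_aut_autrep f : is_aut n f -> exists b, autrep f b.
Proof.
move=> [Hf [g [Hg [efg egf]]]].
pose ext (f : End) i := if (i < n)%N then fgpi (f i) else X i.
have ext_word f1 w : word_in n w -> fev (ext f1) (fgpi w) = fgpi (subst f1 w).
  move=> Hw; rewrite fev_pi; elim: w Hw => [|[i e] w IH] //= /andP[/= lt_i /IH ->].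
  rewrite [subst f1 (_ :: w)]/= fgpi_cat /evl /ext /= lt_i; case: e => //=.
  by rewrite fgpi_inv.
have can_ext f1 f2 : is_end n f2 -> eeq n (Defs.comp f1 f2) idE ->
      cancel (fev (ext f2)) (fev (ext f1)).
  move=> H2 e12 x; apply: (hom_ext (hom_comp (fev_hom _) (fev_hom _))) => // i.
  rewrite fevX {2}/ext; case: ifP => lt_i; last by rewrite fevX /ext lt_i.
  by rewrite ext_word ?H2 //; apply/weqP; apply: e12.
pose b := MkBij (can_ext g f Hf egf) (can_ext f g Hg efg).
exists b; split=> //; last exists g => //.
  by split; [apply: fev_hom | move=> i; exact: fevX].
by split; [apply: fev_hom | move=> i; exact: fevX].
Qed.

Definition repset (H : End -> Prop) (b : bij FG) : Prop := exists2 f, H f & rep f b.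

(** * Lower central series of automorphism groups, from words to bijections and back *)

Section LcsA.
Variable H : End -> Prop.
Hypothesis H_aut : forall f, H f -> is_aut n f.
Hypothesis H_eeq : forall f g, H f -> is_end n g -> eeq n f g -> H g.

Lemma lcsA_lcs k f : lcsA n H k f -> exists2 b, autrep f b & lcs (repset H) k b.
Proof.
have H0 g : H g -> exists2 b, autrep g b & repset H b.
  by move=> Hg; have [b Rb] := is_aut_autrep (H_aut Hg); exists b => //; exists g => //; case: Rb.
elim: k f => [|[|k] IH] f; try exact: H0.
elim=> {f} [f Af [a [c [a' [c' [/IH[b1 R1 L1] [/H0[b2 R2 L2] [ia [ic ef]]]]]]]]
  ||f g _ [b Rf Lb] _ [c Rg Lc]|f g _ [b Rf Lb] ifg|f g _ [b Rf Lb] Hg efg].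
- have [b Rb] := is_aut_autrep Af; exists b => //.
  case: R1 R2 Rb => H1 R1 _ [H2 R2 _] [_ Rb _].
  apply: gen_base; exists b1, b2; split=> //; apply: rep_uniq Rb _.
  have [Ha' Hc'] := (ia.1, ic.1).
  rewrite ef; apply: (rep_comp _ (rep_inverse R1 ia)); first by do ?apply: is_end_comp.
  apply: (rep_comp _ (rep_inverse R2 ic)); first exact: is_end_comp.
  exact: rep_comp.
- by exists 1; [exact: autrep_id | exact: gen_1].
- by exists (b * c); [exact: autrep_comp | exact: gen_M].
- exists b^-1; last exact: gen_V.
  by case: (Rf) => _ Qf _; apply: autrep_inv Rf ifg.1 _; apply: rep_inverse Qf ifg.
- by exists b => //; apply: autrep_eeq Rf.
Qed.

Lemma lcs_lcsA k f b : is_end n f -> rep f b -> lcs (repset H) k b -> lcsA n H k f.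
Proof.
have H0 f1 b1 : is_end n f1 -> rep f1 b1 -> repset H b1 -> H f1.
  move=> H1 R1 [g Hg Rg]; apply: H_eeq Hg H1 _ => i lt_i; apply/weqP.
  by have := R1.2 i; rewrite Rg.2 lt_i.
elim: k f b => [|[|k] IH] f b; try exact: H0.
move=> Hf Rf Lb; suff [g Rg Lg] : exists2 g, autrep g b & lcsA n H k.+2 g.
  apply: genA_eq Lg Hf _ => i lt_i; apply/weqP.
  by case: Rg => _ [_ /(_ i)] + _; rewrite Rf.2 lt_i.
elim: Lb => [_ [b1 [b2 [L1 L2 ->]]]||b1 b2 _ [f1 R1 L1] _ [f2 R2 L2]|b1 _ [f1 R1 L1]].
- have {}L1 : lcs (repset H) k.+1 b1 := L1.
  (* The induction hypothesis needs words representing b1; they exist because represented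
     automorphisms form a subgroup containing [repset H]. *)
  have [f1 R1] : exists f1, autrep f1 b1.
    suff: repset (is_aut n) b1.
      move=> [f1 A1 Q1]; exists f1; have [b' R'] := is_aut_autrep A1.
      by case: (R') => _ Q' _; rewrite (rep_uniq Q1 Q').
    have sA : subgrp (repset (is_aut n)).
      split=> [|b3 b4 [f3 A3 R3] [f4 A4 R4]|b3 [f3 A3 R3]].
      - by exists idE; [apply: autrep_is_aut autrep_id | apply: rep_id].
      - exists (Defs.comp f3 f4); last by apply: rep_comp R4 => //; case: A4.
        have [b3' R3'] := is_aut_autrep A3; have [b4' R4'] := is_aut_autrep A4.
        exact: autrep_is_aut (autrep_comp R3' R4').
      case: (A3) => H3 [g3 i3]; have R := rep_inverse R3 i3; exists g3 => //.
      split; first exact: i3.1.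
      by exists f3; apply: inverse_rep i3.1 H3 R _; rewrite invgK.
    apply: (lcs_sub sA (k := k.+1)); apply: lcs_mono L1 => // b3 [f3 /H_aut A3 R3].
    by exists f3.
  have [f2 A2 Q2] := L2; have [b2' R2] := is_aut_autrep (H_aut A2).
  have e2 : b2' = b2 by case: (R2) => _ + _ => /rep_uniq; apply.
  rewrite {b2'}e2 in R2.
  case: (R1) => H1 Q1 [g1 G1 S1]; case: (R2) => H2 _ [g2 G2 S2].
  have Rc : autrep (Defs.comp g1 (Defs.comp g2 (Defs.comp f1 f2))) [~ b1, b2].
    apply: autrep_comp; first exact: autrep_inv R1 G1 S1.
    by apply: autrep_comp; [exact: autrep_inv R2 G2 S2 | exact: autrep_comp].
  exists (Defs.comp g1 (Defs.comp g2 (Defs.comp f1 f2))) => //.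
  apply: genA_base; first exact: autrep_is_aut Rc.
  exists f1, f2, g1, g2; split; first exact: IH L1.
  by split=> //; split; [exact: inverse_rep Q1 S1 | split; first exact: inverse_rep Q2 S2].
- by exists idE; [exact: autrep_id | exact: genA_id].
- by exists (Defs.comp f1 f2); [exact: autrep_comp | exact: genA_mul].
case: (R1) => H1 Q1 [g1 G1 S1]; exists g1; first exact: autrep_inv R1 G1 S1.
by apply: genA_inv L1 _; apply: inverse_rep Q1 S1.
Qed.

End LcsA.

Lemma artin_rep w : bword_in n w -> is_end n (artin w) /\ rep (artin w) (artinB w).
Proof.
elim: w => [|[i e] w IH]; first by split; [exact: is_end_id | exact: rep_id].
case/andP => /= lt_i /IH[Hw Rw].
have rs (b : bij FG) (f : nat -> word) : ishom b -> (forall t, b (X t) = fgpi (f t)) ->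
    (forall t, (n <= t)%N -> fgpi (f t) = X t) -> rep f b.
  by move=> hb eb et; split=> // t; rewrite eb; case: ltnP => // /et.
rewrite /evl /=; case: e.
  split; first apply: is_end_comp => // t lt_t.
    rewrite /sigmaAinv; case: eqP => _ /=; first by rewrite lt_i.
    by case: eqP => _ /=; rewrite ?lt_t // lt_i (ltnW lt_i).
  apply: rep_comp Rw => //; apply: rs; first exact: sigV_hom.
    by move=> t; rewrite sigVE fgpi_sigmaAinv.
  by move=> t le_t; rewrite fgpi_sigmaAinv -sigVE sigV_id //; lia.
split; first apply: is_end_comp => // t lt_t.
  rewrite /sigmaA; case: eqP => _ /=; first by rewrite lt_i (ltnW lt_i).
  by case: eqP => _ /=; rewrite ?lt_t // (ltnW lt_i).
apply: rep_comp Rw => //; apply: rs; first exact: sig_hom.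
  by move=> t; rewrite sigE fgpi_sigmaA.
by move=> t le_t; rewrite fgpi_sigmaA -sigE sig_id //; lia.
Qed.

Lemma Pn_PB f : Pn n f -> exists2 b, autrep f b & PB n b.
Proof.
move=> [w [Hw [pw [ew Hf]]]]; have [Ha Ra] := artin_rep Hw.
have Hi : bword_in n (inv_word w) by rewrite /bword_in all_rev all_map.
have [Ha' Ra'] := artin_rep Hi.
exists (artinB w); last by split; [exists w | apply/IAB_artin].
apply: autrep_eeq ew Hf _; split=> //; exists (artin (inv_word w)) => //.
by rewrite -ev_inv.
Qed.

Lemma PB_repset b : PB n b <-> repset (Pn n) b.
Proof.
split=> [[[w Hw ->] /IAB_artin pw]|[f /Pn_PB[c [_ Rc _] Pc] Rb]]; last by rewrite (rep_uniq Rb Rc).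
by have [Ha Ra] := artin_rep Hw; exists (artin w) => //; exists w.
Qed.

Lemma Pn_eeq f g : Pn n f -> is_end n g -> eeq n f g -> Pn n g.
Proof.
move=> [w [Hw [pw [ew Hf]]]] Hg efg; exists w; do 3!split=> //.
by move=> i lt_i; rewrite /weq (ew i lt_i); apply: efg.
Qed.

Lemma Pn_rep f b : is_end n f -> rep f b -> PB n b -> Pn n f.
Proof.
move=> Hf Rb /PB_repset[g Pg Rg]; apply: Pn_eeq Pg Hf _ => i lt_i; apply/weqP.
by have := Rb.2 i; rewrite Rg.2 lt_i.
Qed.

Lemma Pn_is_aut f : Pn n f -> is_aut n f.
Proof. by case/Pn_PB => b /autrep_is_aut. Qed.

Lemma IA_IAB f b : autrep f b -> IA n f <-> IAB b.
Proof.
move=> Rf; case: (Rf) => Hf [hb eb] _.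
have eps_f i j : eps j (fgpi (f i)) = epsw j (f i) := eps_pi j (f i).
split=> [[_ cf]|[_ Eb]].
  split=> // u; apply: (eps_ext (f' := id)) => // t; rewrite eb; case: ifP => // lt_t.
  rewrite eps_f epsX; case: (ltnP u n) => [lt_u|le_u].
    by rewrite /epsw (cf t u lt_t lt_u) [u == t]eq_sym; lia.
  have c0 e : count (pred1 (u, e)) (f t) = 0%N.
    apply/eqP; rewrite -leqn0 leqNgt -has_count has_pred1; apply/negP => in_u.
    by have /= := allP (Hf t lt_t) _ in_u; rewrite ltnNge le_u.
  by rewrite /epsw !c0; case: eqP => // e; lia.
split; first exact: autrep_is_aut Rf.
move=> i j lt_i lt_j; have := Eb j (X i); rewrite eb lt_i eps_f epsX /epsw [j == i]eq_sym.
by case: (i == j) => /=; lia.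
Qed.

Lemma Pn_IA f : Pn n f -> IA n f.
Proof. by case/Pn_PB => b Rb [_ Ib]; apply/(IA_IAB Rb). Qed.

Lemma IA_is_aut f : IA n f -> is_aut n f. Proof. by case. Qed.

Lemma Andr_AjB j f b : autrep f b -> Andr n j f <-> AjB j b.
Proof.
move=> Rf; case: (Rf) => Hf Qf _; case: (Qf) => hb eb.
have e x : word_in n x -> fgpi (subst f x ++ inv_word x) = b (fgpi x) * (fgpi x)^-1.
  by move=> Hx; rewrite fgpi_cat fgpi_inv (rep_word Qf).
split=> [[_ Af]|Ab].
  apply: AjB_gen => // i; case: (ltnP i n) => [lt_i|le_i]; last first.
    by rewrite eb ifN -?leqNgt // mulgV; apply: (ns1 lcF_nseries).
  have Hi : word_in n [:: (i, false)] by rewrite /= lt_i.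
  by have [_] := lcsF_lcF (Af _ Hi); rewrite e.
split=> [|x Hx]; first exact: autrep_is_aut Rf.
have Hw : word_in n (subst f x ++ inv_word x).
  by rewrite word_in_cat word_in_inv Hx andbT word_in_subst.
by apply: (lcF_lcsF (Ab (fgpi x)) Hw); rewrite -e // kill_word_in.
Qed.

End Words.

(** [AjB] bounds displacements in weight 1; [ns_shift] and the minimality of [lcF] extend this to
    all weights. For p = 0 a weaker bound is asked, as [lcF 0] and [lcF 1] coincide. *)
Lemma AjB_autS j (b : bij FG) : ishom b -> AjB j b -> autS lcF j b.
Proof.
have shift (c : bij FG) : ishom c -> AjB j c -> forall p g, lcF p g -> lcF (p + j) (c g * g^-1).
  move=> hc Ac [|p] g Lg; first exact: (nsS lcF_nseries (Ac g)).
  have nS := ns_shift lcF_nseries j hc.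
  have := lcs_min (f := id) (H := fun _ => True) nS (fun _ _ => erefl) _ Lg.
  by case=> // h _; split=> //; apply: Ac.
move=> hb Ab; apply/(autSP lcF_nseries); split=> // p g Lg; split; first exact: shift.
by apply: shift => //; [apply: hom_bijV | apply: (sgV (AjB_subgrp j))].
Qed.

Lemma IAB_AjB b : IAB b -> AjB 1 b.
Proof. by move=> [_ Eb] g; apply: lcF_abelianization => i; rewrite epsM epsV Eb; lia. Qed.

Lemma lcs_IAB_AjB j b : (0 < j)%N -> lcs IAB j b -> AjB j b.
Proof.
case: j => // j _ Lb.
have : autS lcF j.+1 b.
  apply: (lcs_min (f := id) (autS_nseries lcF_nseries) _ _ Lb) => // c Ic.
  by apply: AjB_autS; [case: Ic | apply: IAB_AjB].
by move=> /(autSP lcF_nseries)[_ Ab] g; case: (Ab 1%N g I).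
Qed.

Local Close Scope group_scope.

Theorem mainTheorem12 (n j : nat) (hj : 1 <= j) :
  (forall f : End, lcsA n (Pn n) j f <-> (lcsA n (IA n) j f /\ Pn n f)) /\
  (forall f : End, (lcsA n (IA n) j f /\ Pn n f) <-> (Andr n j f /\ Pn n f)).
Proof.
have IA_lcs f : lcsA n (IA n) j f -> Andr n j f.
  move=> /(lcsA_lcs (@IA_is_aut n))[b Rb Lb]; apply/(Andr_AjB _ Rb).
  apply: lcs_IAB_AjB => //; apply: lcs_mono Lb => // c [g Ig Rg].
  have [c' Rc'] := is_aut_autrep (IA_is_aut Ig).
  have -> : c = c' by case: (Rc') => _ R _; apply: rep_uniq Rg R.
  by apply/(IA_IAB Rc').
have Pn_lcs f : lcsA n (Pn n) j f -> lcsA n (IA n) j f /\ Pn n f.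
  move=> /(lcsA_lcs (@Pn_is_aut n))[b [Hf Rb _] Lb]; split; last first.
    apply: (Pn_rep Hf Rb); apply: (lcs_sub (PB_subgrp n) (k := j)).
    by apply: lcs_mono Lb => // c /PB_repset.
  apply: (lcs_lcsA _ _ Hf Rb).
  - exact: IA_is_aut.
  - move=> g h Ig Hh egh; have [c Rc] := is_aut_autrep (IA_is_aut Ig).
    by apply/(IA_IAB (autrep_eeq egh Hh Rc)); apply/(IA_IAB Rc).
  by apply: lcs_mono Lb => // c [g Pg Rg]; exists g => //; apply: Pn_IA.
have Andr_lcs f : Andr n j f -> Pn n f -> lcsA n (Pn n) j f.
  move=> Af /Pn_PB[b Rb Pb]; case: (Rb) => Hf Qb _.
  apply: (lcs_lcsA (@Pn_is_aut n) (@Pn_eeq n) Hf Qb).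
  apply: (@lcs_mono _ (PB n)) => [c /PB_repset //|].
  by apply: PB_AjB_lcs => //; apply/(Andr_AjB _ Rb).
(* The three inclusions form a cycle from Γ_j(P_n) through Γ_j(IA_n) ∩ P_n and A_j ∩ P_n. *)
split=> f; split=> [|[If Pf]].
- exact: Pn_lcs.
- by apply: Andr_lcs => //; apply: IA_lcs.
- by case=> If Pf; split=> //; apply: IA_lcs.
- by apply: Pn_lcs; apply: Andr_lcs.
Qed.
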